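(* Let $\mathcal{T}$ be an infinite, locally finite, rooted tree with branching-ruin number $b=br_r(\mathcal{T})\in[0,\infty]$, and consider the random walk on i.i.d. random conductances (RWRC) on $\mathcal{T}$ whose conductances satisfy $\mathbf{P}(C_e\le 1/t)=L(t)t^{-m}$ for all $t>0$, with $m>0$ and $L$ slowly varying. If $b<1$, then the RWRC is recurrent. Assuming $b>1$: if $mb>1$ then the RWRC is transient, and if $mb<1$ then it is recurrent.
   Context: Tree notation: $\mathcal{T}=(V,E)$ has root $\varrho$; $|\nu|$ is the graph distance from $\nu\in V$ to $\varrho$; each edge $e$ has endpoints $e^-,e^+$ with $|e^+|=|e^-|+1$, and $|e|:=|e^+|$. A cutset is a set $\pi$ of edges such that every infinite self-avoiding path $(\nu_i)_{i\ge 0}$ started at $\varrho$ has exactly one $i\ge1$ with $[\nu_{i-1},\nu_i]\in\pi$; $\Pi$ is the set of cutsets. The branching-ruin number is $$br_r(\mathcal{T})=\sup\Big\{\gamma>0:\ \inf_{\pi\in\Pi}\sum_{e\in\pi}|e|^{-\gamma}>0\Big\}\in[0,\infty]\qquad(\sup\emptyset=0).$$ Environment: $(C_e)_{e\in E}$ are i.i.d. under $\mathbf{P}$, with values in $(0,\infty)$, such that $\mathbf{P}(C_e\le 1/t)=L(t)/t^m$ for all $t>0$, where $L:\mathbb{R}\to\mathbb{R}$ is slowly varying (at infinity) and $m>0$. As a standing normalization, $\mathbf{P}(C_e\ge 1)>0$. Walk: given $\omega=(C_e)_{e\in E}$, under the quenched law $P^\omega_\varrho$ the process $\mathbf{X}=(X_n)_{n\ge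 0}$ is the Markov chain on $V$ with $X_0=\varrho$ and, for neighbors $\mu\sim\nu$, $$P^\omega_\varrho(X_{n+1}=\mu\mid X_n=\nu)=\frac{C_{[\nu,\mu]}}{\sum_{\mu'\sim\nu}C_{[\nu,\mu']}}.$$ The annealed law is $\mathbb{P}_\varrho=\mathbf{P}\times P^\omega_\varrho$ (quenched law averaged over the environment). With $T(\varrho)=\inf\{n>0: X_n=\varrho\}$, the RWRC is transient if $\mathbb{P}_\varrho(T(\varrho)=\infty)>0$, and recurrent otherwise (i.e. it returns to $\varrho$ $\mathbb{P}_\varrho$-almost surely). *)

(* Defs.v *)
From HB Require Import structures.
From mathcomp Require Import all_boot all_order all_algebra.
From mathcomp Require Import all_classical all_reals all_analysis.

Set Implicit Arguments.
Unset Strict Implicit.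
Unset Printing Implicit Defensive.

Import Order.TTheory GRing.Theory Num.Theory.
Import numFieldNormedType.Exports.

Local Open Scope classical_set_scope.
Local Open Scope ring_scope.

Section Graph.
Context (V : choiceType) (adj : rel V).

(* In the last clause, [2 < size c] excludes the closed walk u, v, u along a
   single edge, which [ucycle] accepts. *)
Definition is_tree : Prop :=
  [/\ symmetric adj,
      irreflexive adj,
      (forall u v, exists2 p, path adj u p & last u p = v)
    & (forall c : seq V, (2 < size c)%N -> ~ ucycle adj c)].

Definition locally_finite : Prop :=
  forall v, finite_set [set u | adj v u].

Definition path_lengths (u v : V) : set nat :=
  [set size p | p in [set p | path adj u p /\ last u p = v]].

(* The default value 0 is used only if u and v are not connected. *)
Definition graph_dist (u v : V) : nat :=
  xget 0%N [set n | path_lengths u v n /\ lbound (path_lengths u v) n].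

Variable root : V.

Definition level (v : V) : nat := graph_dist root v.

(* An edge e is encoded as the pair (e^-, e^+) of its endpoints, oriented away
   from the root, so that each undirected edge of the tree occurs once. *)
Definition edges : set (V * V) :=
  [set e | adj e.1 e.2 /\ level e.2 = (level e.1).+1].

Definition edge_level (e : V * V) : nat := level e.2.

(* The edge [u, v] of two adjacent vertices taken in either order. *)
Definition edge (u v : V) : V * V :=
  if (level u < level v)%N then (u, v) else (v, u).

Definition is_ray (x : nat -> V) : Prop :=
  [/\ x 0%N = root, injective x & forall i, adj (x i) (x i.+1)].

Definition cutsets : set (set (V * V)) :=
  [set pi | pi `<=` edges /\
    forall x, is_ray x ->
      exists! i : nat, (0 < i)%N /\ pi (edge (x i.-1) (x i))].

(* All the gamma below are positive, so the maximum with 0 only implements the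
   convention sup set0 = 0 (in \bar R, [ereal_sup set0] is -oo). *)
Definition branching_ruin (R : realType) : \bar R :=
  maxe 0%E (ereal_sup [set gamma%:E | gamma in
    [set gamma : R | 0 < gamma /\
      (0 < ereal_inf
             [set \esum_(e in pi) (((edge_level e)%:R `^ (- gamma))%:E)
             | pi in cutsets])%E]]).

End Graph.

Definition slowly_varying (R : realType) (L : R -> R) : Prop :=
  (exists A : R, measurable_fun `[A, +oo[ L /\ forall t, A <= t -> 0 < L t) /\
  (forall a : R, 0 < a -> L (a * t) / L t @[t --> +oo] --> (1 : R)).

Section Independence.
Context (R : realType) (d : measure_display) (T : measurableType d)
        (P : probability T R) (I : choiceType) (E : set I)
        (C : I -> {RV P >-> R}).

Definition mutually_independent : Prop :=
  forall (s : seq I) (B : I -> set R),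
    uniq s -> (forall i, i \in s -> E i) -> (forall i, measurable (B i)) ->
    P [set w | forall i, i \in s -> B i (C i w)] =
    (\prod_(i <- s) P (C i @^-1` B i))%E.

Definition identically_distributed : Prop :=
  forall i j, E i -> E j -> forall B : set R, measurable B ->
    P (C i @^-1` B) = P (C j @^-1` B).

Definition iid : Prop := mutually_independent /\ identically_distributed.

End Independence.

Definition transition (R : realType) (V : choiceType) (adj : rel V) (root : V)
    (c : V * V -> R) (u v : V) : R :=
  if adj u v then
    c (edge adj root u v) /
      \sum_(v' \in [set v' | adj u v']) c (edge adj root u v')
  else 0.

Section Walk.
Context (R : realType) (V : choiceType) (d : measure_display)
        (T : measurableType d).

(* The events {X n = v} are required to be measurable, i.e. V carries the
   discrete sigma-algebra (the tree has countably many vertices).  The last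
   clause is P(X (n+1) = x (n+1) | X 0 = x 0, ..., X n = x n)
   = p (x n) (x (n+1)), multiplied by the probability of the conditioning
   event so that null events need no special treatment. *)
Definition is_markov_chain (P : set T -> \bar R) (X : nat -> T -> V)
    (x0 : V) (p : V -> V -> R) : Prop :=
  [/\ (forall n v, measurable (X n @^-1` [set v])),
      P (X 0%N @^-1` [set x0]) = 1%E
    & (forall n (x : nat -> V),
        P [set w | forall i, (i <= n.+1)%N -> X i w = x i] =
        (P [set w | forall i, (i <= n)%N -> X i w = x i]
           * (p (x n) (x n.+1))%:E)%E)].

(* T(x0); its value is +oo when the walk never returns to x0. *)
Definition return_time (X : nat -> T -> V) (x0 : V) (w : T) : \bar R :=
  ereal_inf [set (n%:R)%:E | n in [set n | (0 < n)%N /\ X n w = x0]].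

End Walk.

Section RWRC.
Context (R : realType) (V : choiceType) (dO dW : measure_display)
        (Omega : measurableType dO) (W : measurableType dW)
        (P : probability Omega R).

(* Q omega is the quenched law: under it, X is the walk among the
   conductances C e omega.  Measurability in omega is part of the kernel
   structure of Q. *)
Definition is_rwrc (adj : rel V) (root : V) (C : V * V -> {RV P >-> R})
    (Q : R.-pker Omega ~> W) (X : nat -> W -> V) : Prop :=
  forall omega, is_markov_chain (Q omega) X root
    (transition adj root (fun e => C e omega)).

Definition annealed (Q : R.-pker Omega ~> W) (A : set W) : \bar R :=
  (\int[P]_omega Q omega A)%E.

Definition transient (Q : R.-pker Omega ~> W) (X : nat -> W -> V) (root : V)
    : Prop :=
  (0 < annealed Q [set w | return_time R X root w = +oo])%E.

Definition recurrent (Q : R.-pker Omega ~> W) (X : nat -> W -> V) (root : V)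
    : Prop :=
  ~ transient Q X root.

End RWRC.

(* Main.v *)
Require Import Defs.
From HB Require Import structures.
From mathcomp Require Import all_boot all_order all_algebra.
From mathcomp Require Import finmap all_classical all_reals all_analysis.
From mathcomp Require Import measurable_realfun.
From mathcomp Require Import zify lra ring.

Set Implicit Arguments.
Unset Strict Implicit.
Unset Printing Implicit Defensive.

Import Order.TTheory GRing.Theory Num.Theory.
Import numFieldNormedType.Exports.

Local Open Scope classical_set_scope.
Local Open Scope ring_scope.

(** A walk among conductances is an electrical network.  Truncate the tree at
    depth n + 1, and let S_n be the effective conductance between the root and
    level n + 1, obtained by the series and parallel laws from the leaves up
    ([branch_cond], [branch_sum]).  With T the total conductance at the root,
    the walk reaches level n + 1 before returning with probability S_n / T.  In
    discrete time this is used as two inequalities: the probability of not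
    returning at times 1, ..., n + 1 is at least S_n / T ([no_return_ge]), and
    the probability of never returning is at most S_n / T for every n
    ([no_return_le]).  The walk itself enters only through the law of its
    finite trajectories ([measure_no_return]).  Everything is then a matter of
    estimating the random conductances S_n in mean, and two estimates meet at
    the critical value.

    Recurrence.  Cut the tree along a cutset pi.  By the series and parallel
    laws S_n is at most the sum over the cut edges e of 1 / R(e), where R(e) is
    the sum of the resistances 1 / C on the path from the root to e
    ([branch_sum_le_frontier]).  Along a path of length n these are n
    independent variables, with tail P(1/C >= t) of order t^-m.  Their sum is
    at least of order n, by the law of large numbers, and also at least of
    order n^(1/m), the size of the largest term; in the mean,
    E min(1, 1 / R(e)) = O(|e|^-g) for every g < 1 and for every g < 1/m
    ([expect_hit_bound], [decay_rate_sum], [decay_rate_max]).  If the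
    branching-ruin number b is below such a g, there are cutsets along which
    the sum of |e|^-g is arbitrarily small, so the annealed probability of
    never returning is zero ([recurrent_of_decay]).

    Transience.  If g < b, all cutsets have sum of |e|^-g at least some
    c0 > 0, and by max-flow min-cut ([mincut_lower_bound]) each truncated tree
    carries a flow of strength c0 with at most |e|^-g through each edge.  Scale
    it by a small factor eta.  For any flow x_e of strength x, conservation and
    concavity give the deterministic bound
    S_n >= x - sum_e x_e min(1, x_e / C_e)  ([branch_sum_flow]).
    The tail of order m gives E min(1, x / C) = O(x^k) for every k < min(m, 1)
    ([truncated_mean]), and since the flow through each level is x in total,
    the expected loss is at most x eta^k times a multiple of the sum of the
    n^(-g k) ([expect_flow_loss]).  If b > max(1, 1/m), g and k can be chosen
    with g k > 1; then the loss is at most x / 4 for small eta, whatever n is,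
    so the mean of S_n, on an event where T is bounded, stays away from zero
    ([transient_of_moment]).

    The slowly varying factor is absorbed in the exponents: the tail
    G(t) = P(C <= 1/t) satisfies G(2t) / G(t) --> 2^-m, and iterating this gives
    multiples of t^-m1 and t^-m2 as upper and lower bounds, for all m1 < m < m2
    ([doubling_upper], [doubling_lower]). *)

(** * Rooted trees *)

Section SimplePaths.
Context (V : choiceType) (adj : rel V) (tree : is_tree adj).

(** Where two simple paths with the same end points first differ, following one
    of them until it meets the other and coming back along the other closes a
    simple cycle. *)
Lemma simple_path_unique (x : V) (p q : seq V) :
  path adj x p -> uniq (x :: p) -> path adj x q -> uniq (x :: q) ->
  last x p = last x q -> p = q.
Proof.
case: tree => sym irr _ acyc.
elim: p x q => [|a p IH] x [|b q] //.
- by move=> _ _ _ /= /andP[xq _] e; move: xq; rewrite e mem_last.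
- by move=> _ /= /andP[xp _] _ _ e; move: xp; rewrite -e mem_last.
move=> pa up pb uq e.
have [ab|ab] := eqVneq a b.
  subst b; case/andP: pa pb up uq => _ pa /andP[_ pb] /andP[_ up] /andP[_ uq].
  by rewrite (IH a q).
exfalso.
have [z [p1 [p2 [Ep zq np1]]]] : exists z p1 p2, [/\ a :: p = rcons p1 z ++ p2,
    z \in b :: q & ~~ has (mem (b :: q)) p1].
  move: e => /= e.
  have : has (mem (b :: q)) (a :: p).
    by apply/hasP; exists (last a p); rewrite ?mem_last //= e mem_last.
  by case/split_find => z p1 p2 zq np1; exists z, p1, p2.
have [q1 [q2 Eq]] : exists q1 q2, b :: q = rcons q1 z ++ q2.
  by case/path.splitP: zq => q1 q2; exists q1, q2.
apply: (acyc (x :: p1 ++ z :: rev q1)).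
  rewrite /= size_cat /= size_rev.
  case: p1 q1 {np1} Ep Eq => [|? ?] [|? ?] //=; rewrite ?addnS //.
  by move=> [<- _] [Eb _]; rewrite Eb eqxx in ab.
move: pa pb; rewrite Ep Eq !cat_path => /andP[pa _] /andP[pb _].
move: up uq np1; rewrite Ep Eq => {Ep Eq e zq IH}.
rewrite !cons_uniq !mem_cat !mem_rcons !inE !cat_uniq !rcons_uniq !negb_or.
move=> /andP[/andP[/andP[xz xp1] _] /andP[/andP[zp1 up1] _]].
move=> /andP[/andP[/andP[_ xq1] _] /andP[/andP[zq1 uq1] _]] np1.
apply/andP; split.
  rewrite /= rcons_cat cat_path /=.
  move: pa; rewrite rcons_path => /andP[-> ->] /=.
  have := rev_path adj x (rcons q1 z).
  rewrite last_rcons belast_rcons rev_cons => ->.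
  by rewrite (eq_path (e' := adj)) // => u v; rewrite sym.
rewrite /= mem_cat inE mem_rev !negb_or xp1 xz xq1 /=.
rewrite cat_uniq /= up1 mem_rev zq1 rev_uniq uq1 /= andbT negb_or zp1 /=.
apply/hasPn => u; rewrite mem_rev => uq; apply/negP => /= up.
move/hasPn: np1 => /(_ _ up); rewrite /= mem_cat mem_rcons inE uq orbT //.
Qed.
End SimplePaths.

Section RootedTree.
Context (V : choiceType) (adj : rel V) (root : V).
Context (tree : is_tree adj) (lf : locally_finite adj).
Local Notation level := (level adj root).

Lemma simple_path_exists (u v : V) :
  exists p, [/\ path adj u p, uniq (u :: p) & last u p = v].
Proof.
case: tree => _ _ /(_ u v)[p pp <-] _.
by case/shortenP: pp => p' pp' up' _; exists p'.
Qed.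

Lemma size_simple_path (v : V) (p : seq V) :
  path adj root p -> uniq (root :: p) -> last root p = v -> size p = level v.
Proof.
move=> pp up lp; rewrite /level /graph_dist.
have hp : path_lengths adj root v (size p) /\
    lbound (path_lengths adj root v) (size p).
  split; first by exists p.
  move=> _ [q [pq lq] <-].
  case/shortenP: pq lq => q' pq' uq' subq lq'.
  rewrite (simple_path_unique tree pp up pq' uq') ?lp ?lq' //.
  exact: uniq_leq_size (andP uq').2 subq.
case: xgetP => [n _ [hn ln]|/(_ (size p)) //].
by apply/le_anti; rewrite leEnat -!leEnat (ln _ hp.1) (hp.2 _ hn).
Qed.

Lemma level_root : level root = 0%N.
Proof. by rewrite -(@size_simple_path root [::]). Qed.

(** The simple path from the root to u either avoids v, and then extends to v
    by one step, or passes through v, and then v must be its last but one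
    vertex. *)
Lemma adj_level (u v : V) : adj u v ->
  level v = (level u).+1 \/ level u = (level v).+1.
Proof.
case: tree => sym irr _ _ uv.
have [p [pp up lp]] := simple_path_exists root u.
have [vp|vp] := boolP (v \in root :: p); last first.
  left; rewrite -(size_simple_path pp up lp).
  rewrite -(@size_simple_path v (rcons p v)) ?size_rcons ?last_rcons //.
    by rewrite rcons_path pp lp.
  by rewrite -rcons_cons rcons_uniq vp.
right; case/splitPl: vp pp up lp => p1 p2 lv.
rewrite cat_path -cat_cons cat_uniq last_cat lv.
move=> /andP[pp1 pp2] /and3P[up1 np up2] lu.
have up : u \notin root :: p1.
  apply/negP => up; move/hasPn: np => np.
  case: p2 {pp2 up2} lu np => [|w p2] lu np.
    by move: uv; rewrite -lu /= irr.
  by have := np u; rewrite up -{1}lu /= mem_last => /(_ isT).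
rewrite -(size_simple_path pp1 up1 lv).
rewrite -(@size_simple_path u (rcons p1 u)) ?size_rcons ?last_rcons //.
  by rewrite rcons_path pp1 lv sym.
by rewrite -rcons_cons rcons_uniq up.
Qed.

(** Two parents would give two simple paths from the root. *)
Lemma parent_unique (u v w : V) : adj u w -> adj v w ->
  level w = (level u).+1 -> level w = (level v).+1 -> u = v.
Proof.
have ext z (zw : adj z w) (lz : level w = (level z).+1) :
    exists p, [/\ path adj root (rcons p w), uniq (root :: rcons p w)
                & last root p = z].
  have [p [pp up lp]] := simple_path_exists root z.
  exists p; split => //; first by rewrite rcons_path pp lp.
  rewrite -rcons_cons rcons_uniq up andbT.
  apply/negP => wp; case/splitPl: wp pp up lp => p1 p2 lw.
  rewrite cat_path -cat_cons cat_uniq => /andP[pp1 pp2] /and3P[up1 np up2] lp.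
  have := size_simple_path pp1 up1 lw.
  have := @size_simple_path z (p1 ++ p2).
  rewrite cat_path pp1 pp2 -cat_cons cat_uniq up1 np up2 => /(_ isT isT lp).
  by rewrite lz size_cat => <- /eqP; rewrite -addnS -{1}[size p1]addn0 eqn_add2l.
move=> uw vw lu lv.
have [p [pp up <-]] := ext _ uw lu; have [q [pq uq <-]] := ext _ vw lv.
have := simple_path_unique tree pp up pq uq.
by rewrite !last_rcons => /(_ erefl) /rcons_inj [->].
Qed.

(** The root is its own parent. *)
Definition parent (v : V) : V :=
  xget root [set u | adj u v /\ level v = (level u).+1].

Definition children (v : V) : seq V :=
  enum_fset (fset_set [set w | adj v w /\ level w = (level v).+1]).

Lemma parent_eq (u v : V) : adj u v -> level v = (level u).+1 -> parent v = u.
Proof.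
move=> uv lv; rewrite /parent; case: xgetP => [w _ [wv lw]|/(_ u)/not_andP[]//].
exact: parent_unique wv uv lw lv.
Qed.

Lemma level_eq0 (v : V) : level v = 0%N -> v = root.
Proof.
have [p [pp up <-]] := simple_path_exists root v.
by rewrite -(size_simple_path pp up erefl) => /size0nil ->.
Qed.

Lemma parentP (v : V) : v <> root ->
  adj (parent v) v /\ level v = (level (parent v)).+1.
Proof.
have [p [pp up lp]] := simple_path_exists root v.
case/lastP: p pp up lp => [|p w]; first by move=> _ _ <-.
rewrite last_rcons => pp up ? _; subst w.
have lv := size_simple_path pp up (last_rcons _ _ _).
move: pp; rewrite rcons_path => /andP[pp pv].
rewrite -rcons_cons rcons_uniq in up; case/andP: up => _ up.
have := size_simple_path pp up erefl; rewrite size_rcons in lv.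
move=> lp; rewrite lp in lv.
by rewrite (parent_eq pv).
Qed.

Lemma mem_children (v w : V) :
  (w \in children v) = (w != root) && (parent w == v).
Proof.
have fin : finite_set [set w | adj v w /\ level w = (level v).+1].
  by apply: sub_finite_set (lf v) => u [].
rewrite /children.
rewrite -[LHS]/(w \in fset_set [set w | adj v w /\ level w = (level v).+1]).
rewrite in_fset_set //; apply/idP/andP.
  rewrite inE /= => -[vw lw]; split; last by rewrite (parent_eq vw).
  by apply/eqP => ew; rewrite ew level_root in lw.
move=> [/eqP wr /eqP <-]; rewrite inE /=; exact: parentP.
Qed.

Lemma children_uniq (v : V) : uniq (children v).
Proof. exact: fset_uniq. Qed.

Lemma level_parent (v : V) : v <> root -> level v = (level (parent v)).+1.
Proof. by case/parentP. Qed.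

Lemma adj_parent (v : V) : v <> root -> adj (parent v) v.
Proof. by case/parentP. Qed.

Lemma adjE (u v : V) : adj u v =
  (v \in children u) || (u != root) && (v == parent u).
Proof.
case: (tree) => sym irr _ _.
apply/idP/orP; rewrite mem_children.
  move=> uv; case: (adj_level uv) => l.
    left; rewrite (parent_eq uv l) eqxx andbT.
    by apply/eqP => e; rewrite e level_root in l.
  right; rewrite (@parent_eq v u) ?eqxx ?andbT 1?sym //.
  by apply/eqP => e; rewrite e level_root in l.
case=> /andP[/eqP h /eqP e].
  by rewrite -e; exact: adj_parent.
by rewrite e sym; exact: adj_parent.
Qed.

Definition neighbours (v : V) : seq V :=
  if v == root then children v else parent v :: children v.

Lemma mem_neighbours (u v : V) : (v \in neighbours u) = adj u v.
Proof.
rewrite adjE /neighbours; case: eqVneq => [->|ur] /=; first by rewrite orbF.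
by rewrite inE orbC.
Qed.

Lemma neighbours_uniq (v : V) : uniq (neighbours v).
Proof.
rewrite /neighbours; case: eqVneq => [|/eqP vr] /=; first by rewrite children_uniq.
rewrite children_uniq andbT mem_children; apply/negP => /andP[/eqP pr /eqP ppv].
by have := level_parent vr; rewrite (level_parent pr) ppv; lia.
Qed.

Lemma edge_up (v : V) : v <> root -> edge adj root v (parent v) = (parent v, v).
Proof.
by move=> vr; rewrite /edge (level_parent vr) ltnNge leqnSn.
Qed.

Lemma edge_down (v : V) : v <> root -> edge adj root (parent v) v = (parent v, v).
Proof. by move=> vr; rewrite /edge (level_parent vr) leqnn. Qed.

Lemma edges_parent (v : V) : v <> root -> edges adj root (parent v, v).
Proof. by move=> vr; split; [exact: adj_parent | exact: level_parent]. Qed.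

Lemma edgesP (e : V * V) : edges adj root e -> e.2 <> root /\ e = (parent e.2, e.2).
Proof.
case: e => u v [/= uv l]; split; last by rewrite (parent_eq uv).
by move=> e; rewrite e level_root in l.
Qed.

Lemma child_neq (v w : V) : w \in children v -> w <> root.
Proof. by rewrite mem_children => /andP[/eqP]. Qed.

Lemma parent_child (v w : V) : w \in children v -> parent w = v.
Proof. by rewrite mem_children => /andP[_ /eqP]. Qed.

Lemma iter_parent_neq (u : V) i : (i < level u)%N -> iter i parent u <> root.
Proof.
elim: i u => [|i IH] u /= il e; first by rewrite e level_root in il.
have [e'|vr] := pselect (u = root); first by rewrite e' level_root in il.
by apply: (IH (parent u)); rewrite -?iterSr //; rewrite (level_parent vr) in il.
Qed.

Lemma iter_parent_level (u : V) i : (i <= level u)%N ->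
  level (iter i parent u) = (level u - i)%N.
Proof.
elim: i => [|i IH] il /=; first by rewrite subn0.
have ur : iter i parent u <> root by exact: iter_parent_neq.
by have := IH (ltnW il); rewrite (level_parent ur); lia.
Qed.

(** Rays are exactly the infinite descending sequences of children that start
    at the root; this lemma and [ray_parent] are the two directions. *)
Lemma ray_of_children (x : nat -> V) : x 0%N = root ->
  (forall i, x i.+1 \in children (x i)) -> is_ray adj root x.
Proof.
move=> x0 xS.
have step i : x i.+1 <> root /\ parent (x i.+1) = x i.
  by have := xS i; rewrite mem_children => /andP[/eqP ? /eqP].
have lx i : level (x i) = i.
  elim: i => [|i IH]; first by rewrite x0 level_root.
  by rewrite level_parent ?(step i).2 ?IH //; exact: (step i).1.
split => //; first by move=> i j e; rewrite -(lx i) e lx.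
by move=> i; rewrite -(step i).2; apply: adj_parent; exact: (step i).1.
Qed.

Lemma ray_parent (x : nat -> V) : is_ray adj root x ->
  forall i, x i.+1 <> root /\ parent (x i.+1) = x i.
Proof.
move=> [x0 xinj xadj] i.
have xr j : x j.+1 <> root by rewrite -x0 => /xinj.
split=> //; elim: i => [|i IH].
  have := xadj 0%N; rewrite adjE {2 3}x0 eqxx orbF mem_children.
  by move=> /andP[_ /eqP].
have := xadj i.+1; rewrite adjE mem_children.
move=> /orP[/andP[_ /eqP //]|/andP[_ /eqP]].
by rewrite IH => /xinj; lia.
Qed.

Lemma ray_level (x : nat -> V) i : is_ray adj root x -> level (x i) = i.
Proof.
move=> rx; elim: i => [|i IH].
  by case: rx => -> _ _; rewrite level_root.
by have [h p] := ray_parent rx i; rewrite (level_parent h) p IH.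
Qed.

Lemma ray_iter_parent (x : nat -> V) i j : is_ray adj root x -> (j <= i)%N ->
  iter j parent (x i) = x (i - j)%N.
Proof.
move=> rx; elim: j => [|j IH] ji; first by rewrite subn0.
rewrite iterS IH ?(ltnW ji) // (_ : (i - j)%N = (i - j.+1).+1); last lia.
by rewrite (ray_parent rx _).2.
Qed.

End RootedTree.

(** * Conductances of branches and escape probabilities *)

Section Network.
Context (R : realType) (V : choiceType) (adj : rel V) (root : V).
Context (tree : is_tree adj) (lf : locally_finite adj).
Context (c : V * V -> R) (c_gt0 : forall e, edges adj root e -> 0 < c e).
Local Notation level := (level adj root).
Local Notation parent := (parent adj root).
Local Notation children := (children adj root).
Local Notation neighbours := (neighbours adj root).
Local Notation p := (transition adj root c).

(** Edges are indexed by their lower end points. *)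
Definition up_cond (v : V) : R := c (parent v, v).

(** Effective conductance of the edge above v in series with the subtree of v
    down to k levels below v, with all the vertices at that depth identified:
    the children of v are in parallel with total conductance S.  The quotient
    [branch_cond k v / up_cond v] is the probability, from v, of reaching that
    depth before the parent of v. *)
Fixpoint branch_cond (k : nat) (v : V) : R :=
  if k is k'.+1 then
    let S := \sum_(w <- children v) branch_cond k' w in
    up_cond v * S / (up_cond v + S)
  else up_cond v.

Definition branch_sum k v : R := \sum_(w <- children v) branch_cond k w.

Definition child_sum v : R := \sum_(w <- children v) up_cond w.

Lemma branch_condS k v : branch_cond k.+1 v =
  up_cond v * branch_sum k v / (up_cond v + branch_sum k v).
Proof. by []. Qed.

Lemma up_cond_gt0 v : v <> root -> 0 < up_cond v.
Proof. by move=> vr; apply/c_gt0/edges_parent. Qed.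

Lemma up_cond_child_gt0 v w : w \in children v -> 0 < up_cond w.
Proof. by move=> /(child_neq tree lf); exact: up_cond_gt0. Qed.

Lemma branch_cond_ge0 k v : v <> root -> 0 <= branch_cond k v.
Proof.
elim: k v => [|k IH] v vr; first by rewrite ltW ?up_cond_gt0.
have S0 : 0 <= branch_sum k v.
  by rewrite /branch_sum big_seq sumr_ge0 // => w /(child_neq tree lf); exact: IH.
have C0 := up_cond_gt0 vr.
by rewrite branch_condS divr_ge0 ?mulr_ge0 ?addr_ge0 ?(ltW C0).
Qed.

Lemma branch_sum_ge0 k v : 0 <= branch_sum k v.
Proof.
by rewrite /branch_sum big_seq sumr_ge0 // => w /(child_neq tree lf); exact: branch_cond_ge0.
Qed.

Lemma branch_cond_le k v : v <> root -> branch_cond k v <= up_cond v.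
Proof.
case: k => [//|k] vr; rewrite branch_condS.
have C0 := up_cond_gt0 vr; have S0 := branch_sum_ge0 k v.
by rewrite ler_pdivrMr ?ltr_wpDr // ler_wpM2l ?(ltW C0) // lerDr ltW.
Qed.

Lemma child_sum_ge0 v : 0 <= child_sum v.
Proof.
by rewrite /child_sum big_seq sumr_ge0 // => w /up_cond_child_gt0/ltW.
Qed.

Lemma branch_sum_le k v : branch_sum k v <= child_sum v.
Proof.
rewrite /branch_sum /child_sum big_seq [leRHS]big_seq ler_sum // => w.
by move=> /(child_neq tree lf); exact: branch_cond_le.
Qed.

Definition total_cond v : R :=
  (if v == root then 0 else up_cond v) + child_sum v.

Lemma sum_neighbours v (h : V -> R) :
  \sum_(w <- neighbours v) c (edge adj root v w) * h w =
  (if v == root then 0 else up_cond v * h (parent v)) +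
  \sum_(w <- children v) up_cond w * h w.
Proof.
have E : \sum_(w <- children v) c (edge adj root v w) * h w =
         \sum_(w <- children v) up_cond w * h w.
  apply: eq_big_seq => w wv; rewrite -[v in edge _ _ v](parent_child tree lf wv).
  by rewrite edge_down //; exact: (child_neq tree lf wv).
rewrite /neighbours; case: eqVneq => [vr|/eqP vr]; first by rewrite E add0r.
by rewrite big_cons edge_up // E.
Qed.

Lemma transitionE v w : w \in neighbours v ->
  p v w = c (edge adj root v w) / total_cond v.
Proof.
rewrite mem_neighbours // /transition => ->; congr (_ / _).
have -> : [set v' | adj v v'] = [set` neighbours v].
  by apply/seteqP; split => u /=; rewrite mem_neighbours.
rewrite -fsbig_seq ?neighbours_uniq //=.
transitivity (\sum_(w <- neighbours v) c (edge adj root v w) * 1).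
  by apply: eq_bigr => u _; rewrite mulr1.
rewrite (sum_neighbours v (fun=> 1)) mulr1; congr (_ + _).
by apply: eq_bigr => u _; rewrite mulr1.
Qed.

Lemma sum_transition v (h : V -> R) : total_cond v != 0 ->
  total_cond v * \sum_(w <- neighbours v) p v w * h w =
  (if v == root then 0 else up_cond v * h (parent v)) +
  \sum_(w <- children v) up_cond w * h w.
Proof.
move=> t0; rewrite -sum_neighbours mulr_sumr; apply: eq_big_seq => w wv.
by rewrite transitionE // mulrA mulrCA divff // mulr1.
Qed.

Context (Vinf : infinite_set [set: V]).

Lemma children_root_neq0 : children root != [::].
Proof.
apply/eqP => E; apply: Vinf.
suff -> : [set: V] = [set root] by exact: finite_set1.
apply/seteqP; split => // v _ /=; case: tree => _ _ /(_ root v)[[//|w q]] /=.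
move=> /andP[rw _] _ _; move: rw; rewrite (adjE root tree lf) E eqxx //.
Qed.

Lemma total_cond_gt0 v : 0 < total_cond v.
Proof.
rewrite /total_cond; case: eqVneq => [->|/eqP vr].
  rewrite add0r /child_sum big_seq.
  case: (children root) (@up_cond_child_gt0 root) children_root_neq0 => // w s H _.
  rewrite -big_seq big_cons ltr_wpDr ?H ?mem_head //.
  by rewrite big_seq sumr_ge0 // => u us; rewrite ltW // H // inE us orbT.
by rewrite ltr_wpDr ?child_sum_ge0 ?up_cond_gt0.
Qed.

Lemma sum_transition1 v : \sum_(w <- neighbours v) p v w = 1.
Proof.
have t0 := lt0r_neq0 (total_cond_gt0 v).
transitivity (\sum_(w <- neighbours v) p v w * 1).
  by apply: eq_bigr => u _; rewrite mulr1.
apply: (mulfI t0); rewrite (sum_transition (fun=> 1) t0) mulr1 mulr1.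
by congr (_ + _); apply: eq_bigr => u _; rewrite mulr1.
Qed.

Lemma transition_ge0 v w : w \in neighbours v -> 0 <= p v w.
Proof.
move=> wv; rewrite transitionE // divr_ge0 ?(ltW (total_cond_gt0 v)) //.
move: wv; rewrite mem_neighbours // (adjE root tree lf).
case/orP=> [wv|/andP[/eqP vr /eqP ->]].
  rewrite -[v](parent_child tree lf wv) edge_down //; last exact: (child_neq tree lf wv).
  by rewrite ltW //; exact: up_cond_child_gt0 wv.
by rewrite edge_up // ltW //; exact: up_cond_gt0.
Qed.

(** Probability that the walk started at v avoids the root at all times
    from 0 to N. *)
Fixpoint avoid (N : nat) (v : V) : R :=
  if v == root then 0
  else if N is N'.+1 then \sum_(w <- neighbours v) p v w * avoid N' w else 1.

Lemma avoid_root N : avoid N root = 0.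
Proof. by case: N => [|N] /=; rewrite eqxx. Qed.

Lemma avoid0 v : v <> root -> avoid 0 v = 1.
Proof. by move=> /eqP/negbTE /= ->. Qed.

Lemma avoidS N v : v <> root ->
  avoid N.+1 v = \sum_(w <- neighbours v) p v w * avoid N w.
Proof. by move=> /eqP/negbTE /= ->. Qed.

Lemma avoid_ge0 N v : 0 <= avoid N v.
Proof.
elim: N v => [|N IH] v; first by rewrite /=; case: ifP.
rewrite /=; case: ifP => // _; rewrite big_seq sumr_ge0 // => w wv.
by rewrite mulr_ge0 ?transition_ge0.
Qed.

Lemma avoid_le1 N v : avoid N v <= 1.
Proof.
elim: N v => [|N IH] v; first by rewrite /=; case: ifP.
rewrite /=; case: ifP => // _; rewrite -(sum_transition1 v) big_seq [leRHS]big_seq.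
by apply: ler_sum => w wv; rewrite ler_piMr ?transition_ge0.
Qed.

Lemma avoid_antitone N v : avoid N.+1 v <= avoid N v.
Proof.
elim: N v => [|N IH] v.
  by have [->|/eqP vr] := eqVneq v root; rewrite ?avoid_root // avoid0 // avoid_le1.
have [->|/eqP vr] := eqVneq v root; first by rewrite !avoid_root.
rewrite !avoidS // big_seq [leRHS]big_seq; apply: ler_sum => w wv.
by rewrite ler_wpM2l ?transition_ge0.
Qed.

Lemma branch_cond_complement k v : v <> root ->
  up_cond v - branch_cond k.+1 v =
  up_cond v * (up_cond v / (up_cond v + branch_sum k v)).
Proof.
move=> vr; rewrite branch_condS.
have C0 := up_cond_gt0 vr; have S0 := branch_sum_ge0 k v.
have /lt0r_neq0 CS : 0 < up_cond v + branch_sum k v by rewrite ltr_wpDr.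
by field.
Qed.

(** In probabilistic terms: to avoid the root up to time N it suffices to reach
    depth N below v before the parent of v, which takes at least N steps, or
    else to avoid the root from the parent.  Since [avoid] is nonincreasing in
    time, no bookkeeping of the time spent is needed. *)
Lemma avoid_lower N v : v <> root ->
  branch_cond N v + (up_cond v - branch_cond N v) * avoid N (parent v)
  <= up_cond v * avoid N v.
Proof.
elim: N v => [|N IH] v vr.
  by rewrite /= subrr mul0r addr0; move/eqP/negbTE: vr => ->; rewrite mulr1.
set a := avoid N.+1 v; set y := avoid N.+1 (parent v).
set S := branch_sum N v; set U := up_cond v.
have U0 : 0 < U := up_cond_gt0 vr; have S0 : 0 <= S := branch_sum_ge0 N v.
have US : 0 < U + S by rewrite ltr_wpDr.
rewrite branch_cond_complement // branch_condS -/U -/S.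
rewrite -[U * S / _]mulrA -[U * _ * y]mulrA -mulrDr ler_pM2l // mulrAC -mulrDl.
rewrite ler_pdivrMr // addrC.
have := @sum_transition v (avoid N) (lt0r_neq0 (total_cond_gt0 v)).
rewrite -avoidS // -/a /total_cond; move/eqP/negbTE: (vr) => ->; rewrite -/U.
have H1 : U * y <= U * avoid N (parent v) by rewrite ler_pM2l // avoid_antitone.
have H2 : S + (child_sum v - S) * a <= \sum_(w <- children v) up_cond w * avoid N w.
  apply: (@le_trans _ _ (S + (child_sum v - S) * avoid N v)).
    by rewrite lerD2l ler_wpM2l ?avoid_antitone // subr_ge0 branch_sum_le.
  rewrite /S /branch_sum /child_sum -sumrB mulr_suml -big_split /= big_seq.
  rewrite [leRHS]big_seq; apply: ler_sum => w wv.
  by have := IH w (child_neq tree lf wv); rewrite (parent_child tree lf wv).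
move: H1 H2; lra.
Qed.

(** A maximum principle, in the form of an induction from depth k upwards: a
    harmonic function bounded by 1 is at most the harmonic function with
    boundary value 1 at depth k and the same value at the parent of v. *)
Lemma harmonic_upper (f : V -> R) : (forall v, f v <= 1) ->
  (forall v, v <> root -> f v = \sum_(w <- neighbours v) p v w * f w) ->
  forall k v, v <> root ->
  up_cond v * f v <=
    branch_cond k v + (up_cond v - branch_cond k v) * f (parent v).
Proof.
move=> f1 harm; elim=> [|k IH] v vr.
  by rewrite /= subrr mul0r addr0 ler_piMr // ltW // up_cond_gt0.
set S := branch_sum k v; set U := up_cond v.
have U0 : 0 < U := up_cond_gt0 vr; have S0 : 0 <= S := branch_sum_ge0 k v.
have US : 0 < U + S by rewrite ltr_wpDr.
rewrite branch_cond_complement // branch_condS -/U -/S.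
rewrite -[U * S / _]mulrA -[U * _ * f _]mulrA -mulrDr ler_pM2l // mulrAC -mulrDl.
rewrite ler_pdivlMr //.
have := @sum_transition v f (lt0r_neq0 (total_cond_gt0 v)).
rewrite -harm // /total_cond; move/eqP/negbTE: (vr) => ->; rewrite -/U.
have H2 : \sum_(w <- children v) up_cond w * f w <= S + (child_sum v - S) * f v.
  rewrite /S /branch_sum /child_sum -sumrB mulr_suml -big_split /= big_seq.
  rewrite [leRHS]big_seq; apply: ler_sum => w wv.
  by have := IH w (child_neq tree lf wv); rewrite (parent_child tree lf wv).
move: H2; lra.
Qed.

Lemma avoid_cvg v : avoid n v @[n --> \oo] --> inf [set avoid n v | n in [set: nat]].
Proof.
apply: nonincreasing_cvgn; first by apply/nonincreasing_seqP => n; exact: avoid_antitone.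
by exists 0 => _ [n _ <-]; exact: avoid_ge0.
Qed.

(** Probability of no return to the root at times 1, ..., N + 1. *)
Definition no_return N : R := \sum_(w <- neighbours root) p root w * avoid N w.

Lemma no_return_ge N : branch_sum N root / total_cond root <= no_return N.
Proof.
rewrite ler_pdivrMr ?total_cond_gt0 // mulrC.
rewrite sum_transition ?lt0r_neq0 ?total_cond_gt0 // eqxx add0r /branch_sum.
rewrite big_seq [leRHS]big_seq; apply: ler_sum => w wr.
have := avoid_lower N (child_neq tree lf wr).
by rewrite (parent_child tree lf wr) avoid_root mulr0 addr0.
Qed.

(** The limit in N of [avoid N] is harmonic off the root, where it vanishes, so
    that [harmonic_upper] applies to it. *)
Lemma no_return_le (q : R) k : (forall N, q <= no_return N) ->
  q <= branch_sum k root / total_cond root.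
Proof.
move=> hq; pose f v := inf [set avoid n v | n in [set: nat]].
have f_cvg v : avoid n v @[n --> \oo] --> f v by exact: avoid_cvg.
have sum_cvg v : \sum_(w <- neighbours v) p v w * avoid n w @[n --> \oo] -->
    \sum_(w <- neighbours v) p v w * f w.
  elim: (neighbours v) => [|w s IH].
    by under eq_fun do rewrite big_nil; rewrite big_nil; exact: cvg_cst.
  under eq_fun do rewrite big_cons; rewrite big_cons.
  by apply: cvgD => //; apply: cvgMl_tmp; exact: f_cvg.
have qf : q <= \sum_(w <- neighbours root) p root w * f w.
  apply: (cvgr_to_ge (sum_cvg root)); apply: nearW => n; exact: hq.
have f1 v : f v <= 1.
  by apply: (cvgr_to_le (f_cvg v)); apply: nearW => n; exact: avoid_le1.
have harm v : v <> root -> f v = \sum_(w <- neighbours v) p v w * f w.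
  move=> vr; apply: (@cvg_unique _ _ (avoid n.+1 v @[n --> \oo])) => //.
    by have := f_cvg v; rewrite -(cvg_shiftS (avoid^~ v)).
  rewrite /= (_ : (fun n => avoid n.+1 v) =
    fun n => \sum_(w <- neighbours v) p v w * avoid n w) //.
  by apply/funext => n; rewrite avoidS.
have f0 : f root = 0.
  apply: (@cvg_unique _ _ (avoid n root @[n --> \oo])) => //; first exact: f_cvg.
  rewrite /= (_ : (fun n => avoid n root) = cst 0); first exact: cvg_cst.
  by apply/funext => n; rewrite avoid_root.
apply: (le_trans qf); rewrite ler_pdivlMr ?total_cond_gt0 // mulrC.
rewrite sum_transition ?lt0r_neq0 ?total_cond_gt0 // eqxx add0r /branch_sum.
rewrite big_seq [leRHS]big_seq; apply: ler_sum => w wr.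
have := harmonic_upper f1 harm k (child_neq tree lf wr).
by rewrite (parent_child tree lf wr) f0 mulr0 addr0.
Qed.

End Network.

(** * The law of the quenched walk *)

Section MarkovChain.
Context (R : realType) (V : choiceType) (d : measure_display)
  (W : measurableType d) (Q : {measure set W -> \bar R}).
Context (Q1 : Q setT = 1%E).
Context (X : nat -> W -> V) (root : V) (p : V -> V -> R).
Context (X_chain : is_markov_chain Q X root p).
Context (nb : V -> seq V) (nb_uniq : forall v, uniq (nb v)).
Context (p_sum : forall v, \sum_(w <- nb v) p v w = 1).

Let mX n v : measurable (X n @^-1` [set v]).
Proof. by case: X_chain. Qed.

Definition trajectory n (x : nat -> V) : set W :=
  [set w | forall i, (i <= n)%N -> X i w = x i].

Definition hits n (v : V) : set W := X n @^-1` [set v].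

Lemma trajectoryS n x :
  trajectory n.+1 x = trajectory n x `&` hits n.+1 (x n.+1).
Proof.
apply/seteqP; split => w.
  by move=> h; split; [move=> i il; apply: h; rewrite leqW | exact: h].
move=> [h e] i; rewrite leq_eqVlt => /orP[/eqP -> //|]; exact: h.
Qed.

Lemma measurable_trajectory n x : measurable (trajectory n x).
Proof.
elim: n => [|n IH].
  suff -> : trajectory 0 x = hits 0 (x 0%N) by exact: mX.
  by apply/seteqP; split => w; [apply | move=> e i; rewrite leqn0 => /eqP ->].
by rewrite trajectoryS; apply: measurableI => //; exact: mX.
Qed.

Lemma measure_step n x (v : V) :
  Q (trajectory n x `&` hits n.+1 v) = (Q (trajectory n x) * (p (x n) v)%:E)%E.
Proof.
case: X_chain => _ _ /(_ n (fun i => if (i <= n)%N then x i else v)).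
have E k (y : nat -> V) : (forall i, (i <= k)%N -> y i = x i) ->
    trajectory k y = trajectory k x.
  by move=> h; apply/seteqP; split => w H i ik; move: (H _ ik); rewrite h.
rewrite -!/(trajectory _ _) trajectoryS E; last by move=> i ->.
by rewrite leqnn ltnn.
Qed.

Lemma measurable_mem n (s : seq V) : measurable [set w | X n w \in s].
Proof.
suff -> : [set w | X n w \in s] = \big[setU/set0]_(v <- s) hits n v.
  by apply: bigsetU_measurable => u _; exact: mX.
rewrite -bigcup_seq; apply/seteqP; split => w /=.
  by move=> h; exists (X n w).
by move=> [u us']; rewrite /hits /= => ->.
Qed.

Lemma measure_split_seq (D : set W) n (s : seq V) : measurable D -> uniq s ->
  Q (D `&` [set w | X n w \in s]) = (\sum_(v <- s) Q (D `&` hits n v))%E.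
Proof.
move=> mD; elim: s => [|v s IH] /= => [_|/andP[vs us]].
  rewrite big_nil (_ : _ `&` _ = set0) ?measure0 //.
  by apply/seteqP; split => w // -[].
rewrite big_cons -IH //.
have ms := measurable_mem n s.
rewrite -measureU //; [|by apply: measurableI => //; exact: mX|exact: measurableI|].
  congr (Q _); rewrite -setIUr; congr (_ `&` _).
  apply/seteqP; split => w /=; rewrite inE.
    by move=> /orP[/eqP|]; [left|right].
  by move=> [->|->]; rewrite ?eqxx ?orbT.
apply/seteqP; split => w // -[[_ /= e] [_ /=]].
by rewrite e (negbTE vs).
Qed.

Lemma measure_fin (D : set W) : measurable D -> (Q D < +oo)%E.
Proof.
move=> mD; apply: (@le_lt_trans _ _ (Q setT)); last by rewrite Q1 ltry.
by rewrite le_measure ?inE.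
Qed.

Lemma measure_diff_cap (A B : set W) : measurable A -> measurable B ->
  Q A = (Q (A `\` B) + Q (A `&` B))%E.
Proof. exact: measureDI. Qed.

(** Along a trajectory the next position is almost surely one of the finitely
    many neighbours, because the transition probabilities to them add up to
    one. *)
Lemma measure_split (D : set W) n x : measurable D -> D `<=` trajectory n x ->
  Q D = (\sum_(v <- nb (x n)) Q (D `&` hits n.+1 v))%E.
Proof.
move=> mD sD; rewrite -measure_split_seq //.
set N := [set w | X n.+1 w \in nb (x n)].
have mN : measurable N by exact: measurable_mem.
have mE := measurable_trajectory n x.
have E1 : Q (trajectory n x `&` N) = Q (trajectory n x).
  rewrite measure_split_seq //; under eq_bigr do rewrite measure_step.
  rewrite -fin_num_sume_distrr //; first by rewrite sumEFin p_sum mule1.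
  by rewrite ge0_fin_numE // measure_fin.
have E0 : Q (trajectory n x `\` N) = 0%E.
  have := measure_diff_cap mE mN.
  rewrite E1 -[Q (_ `\` _)]fineK; last first.
    by rewrite ge0_fin_numE // measure_fin //; exact: measurableD.
  rewrite -[Q (trajectory n x)]fineK; last by rewrite ge0_fin_numE // measure_fin.
  by rewrite -EFinD => -[] e; congr (_%:E); move: e; lra.
rewrite (measure_diff_cap mD mN).
rewrite (_ : Q (D `\` N) = 0%E) ?add0e //.
apply: subset_measure0 E0; [exact: measurableD|exact: measurableD|].
by move=> w [/sD Dw Nw].
Qed.

Context (av : nat -> V -> R) (av_root : forall N, av N root = 0).
Context (av0 : forall v, v <> root -> av 0 v = 1).
Context (avS : forall N v, v <> root ->
  av N.+1 v = \sum_(w <- nb v) p v w * av N w).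

Definition no_hit n N : set W :=
  [set w | forall i, (n < i <= n + N)%N -> X i w <> root].

Lemma measurable_no_hit n N : measurable (no_hit n N).
Proof.
rewrite (_ : no_hit n N = \bigcap_(i in [set i | (n < i <= n + N)%N])
    ~` (X i @^-1` [set root])); last first.
  by apply/seteqP; split.
apply: bigcap_measurableType => i _; apply: measurableC; exact: mX.
Qed.

(** One step of the Markov property: condition on the position at time n + 1.
    The recursion of av is the one of the probability of avoiding the root. *)
Lemma measure_no_hit_step n x N :
  (forall m y, y m <> root ->
     Q (trajectory m y `&` no_hit m N) = (Q (trajectory m y) * (av N (y m))%:E)%E) ->
  Q (trajectory n x `&` no_hit n N.+1) =
  (Q (trajectory n x) * (\sum_(w <- nb (x n)) p (x n) w * av N w)%:E)%E.
Proof.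
move=> IH; have mT := measurable_trajectory; have mH := measurable_no_hit.
rewrite (@measure_split _ n x) //; last exact: measurableI.
rewrite -sumEFin fin_num_sume_distrr //; last by rewrite ge0_fin_numE // measure_fin.
apply: eq_bigr => v _; have [->|/eqP vr] := eqVneq v root.
  rewrite av_root mulr0 mule0 (_ : _ `&` _ = set0) ?measure0 //.
  apply/seteqP; split => w // -[[_ /(_ n.+1)]].
  by rewrite ltnS leqnn /= -addn1 leq_add2l //= => /(_ isT) h /h.
rewrite EFinM muleA -measure_step.
pose y i := if (i <= n)%N then x i else v.
have yn : y n.+1 = v by rewrite /y ltnn.
have E : trajectory n x `&` hits n.+1 v = trajectory n.+1 y.
  rewrite trajectoryS yn; congr (_ `&` _).
  by apply/seteqP; split => w h i ik; move: (h _ ik); rewrite /y ik.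
have := IH n.+1 y; rewrite yn -E => <- //.
congr (Q _); rewrite -!setIA; congr (_ `&` _); rewrite setIC.
apply/seteqP; split => w /= [e h]; split => // i.
  by move=> /andP[ni il]; apply: h; rewrite (ltnW ni) /= addnS -addSn.
rewrite addnS -addSn leq_eqVlt => /andP[/orP[/eqP <- _|ni il]].
  by rewrite e.
by apply: h; rewrite ni.
Qed.

Lemma measure_no_hit n x N : x n <> root ->
  Q (trajectory n x `&` no_hit n N) = (Q (trajectory n x) * (av N (x n))%:E)%E.
Proof.
elim: N n x => [|N IH] n x xr.
  rewrite av0 // mule1 (_ : no_hit n 0 = setT) ?setIT //.
  by apply/seteqP; split => w // _ i; rewrite addn0 => /andP[]; lia.
by rewrite measure_no_hit_step // avS.
Qed.

Lemma measure_no_return N : Q (no_hit 0 N.+1) =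
  (\sum_(w <- nb root) p root w * av N w)%:E.
Proof.
have := @measure_no_hit_step 0 (fun=> root) N.
move=> /(_ (fun m y => @measure_no_hit m y N)).
have E : trajectory 0 (fun=> root) = X 0 @^-1` [set root].
  by apply/seteqP; split => w; [apply | move=> e i; rewrite leqn0 => /eqP ->].
have T1 : Q (trajectory 0 (fun=> root)) = 1%E by rewrite E; case: X_chain.
rewrite T1 mul1e => <-.
have mT := measurable_trajectory 0 (fun=> root); have mH := measurable_no_hit 0 N.+1.
rewrite (measure_diff_cap mH mT) setIC.
rewrite (_ : Q (_ `\` _) = 0%E) ?add0e //.
have C0 : Q (~` trajectory 0 (fun=> root)) = 0%E.
  have := measure_diff_cap measurableT mT.
  rewrite setTI setTD Q1 T1 -[Q (~` _)]fineK.
    by rewrite -EFinD => -[] e; congr (_%:E); move: e; lra.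
  by rewrite ge0_fin_numE // measure_fin //; exact: measurableC.
apply: subset_measure0 C0; [exact: measurableD|exact: measurableC|].
by move=> w [].
Qed.

Lemma return_time_infty : [set w | return_time R X root w = +oo%E] =
  \bigcap_N no_hit 0 N.+1.
Proof.
apply/seteqP; split => w /=.
  move=> h N _ i /andP[i0 _] e.
  have : (return_time R X root w <= i%:R%:E)%E by apply: ereal_inf_lbound; exists i.
  by rewrite h leye_eq.
move=> h; rewrite /return_time (_ : [set _ | _ in _] = set0) ?ereal_inf0 //.
apply/seteqP; split => //= y [i [i0 e] _]; apply: (h i) e => //=.
by rewrite i0 add0n leqnSn.
Qed.

Lemma measurable_return_time_infty :
  measurable [set w | return_time R X root w = +oo%E].
Proof.
rewrite return_time_infty; apply: bigcap_measurableType => N _.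
exact: measurable_no_hit.
Qed.

End MarkovChain.

(** * Cutsets and path resistances *)

Lemma uniq_flatten_map (I J : eqType) (s : seq I) (f : I -> seq J) :
  uniq s -> (forall i, i \in s -> uniq (f i)) ->
  (forall i j u, i \in s -> j \in s -> u \in f i -> u \in f j -> i = j) ->
  uniq (flatten [seq f i | i <- s]).
Proof.
elim: s => [//|i s IH] /= /andP[is_ us] uf df.
rewrite cat_uniq uf ?mem_head //= IH //; first last.
- by move=> j k u js ks; apply: df; rewrite inE ?js ?ks orbT.
- by move=> j js; apply: uf; rewrite inE js orbT.
rewrite andbT; apply/hasPn => u /flatten_mapP[j js uj]; apply/negP => ui.
have e : i = j by apply: (df i j u); rewrite ?mem_head // inE js orbT.
by rewrite e js in is_.
Qed.

Section Konig.
Context (V : choiceType) (adj : rel V) (root : V).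
Context (tree : is_tree adj) (lf : locally_finite adj).
Local Notation level := (level adj root).
Local Notation parent := (parent adj root).
Local Notation children := (children adj root).

Context (pi : set (V * V)) (cpi : cutsets adj root pi).

Definition cut (v : V) : bool := `[< pi (parent v, v) >].

(** Every descending path from v of length k meets a cut edge, the edge above v
    included. *)
Fixpoint crossed (k : nat) (v : V) : bool :=
  cut v || if k is k'.+1 then all (crossed k') (children v) else false.

Lemma crossedS k v : crossed k v -> crossed k.+1 v.
Proof.
elim: k v => [|k IH] v; first by rewrite /= orbF => ->.
rewrite /= => /orP[->//|h]; apply/orP; right.
by apply: sub_all h => w; exact: IH.
Qed.

Lemma crossed_le k k' v : (k <= k')%N -> crossed k v -> crossed k' v.
Proof.
move=> /subnK <-; elim: (k' - k)%N => // n IH /IH.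
by rewrite addSn; exact: crossedS.
Qed.

Lemma crossed_seq (s : seq V) : (forall w, w \in s -> exists k, crossed k w) ->
  exists k, all (crossed k) s.
Proof.
elim: s => [|w s IH] h; first by exists 0%N.
have [k hk] := h w (mem_head _ _).
have [|k' hk'] := IH; first by move=> u us; apply: h; rewrite inE us orbT.
exists (maxn k k') => /=; rewrite (crossed_le (leq_maxl _ _) hk) /=.
by apply: sub_all hk' => u; apply: crossed_le; exact: leq_maxr.
Qed.

(** König's lemma: otherwise, by local finiteness, an infinite descending path
    could be built that never meets the cutset. *)
Lemma cutset_bounded : exists k, all (crossed k) (children root).
Proof.
apply: contrapT => /forallNP unb0.
pose bad v := forall k, ~ all (crossed k) (children v).
pose good_step v w := w \in children v /\ (~~ cut w /\ bad w).
have next v : bad v -> exists w, good_step v w.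
  move=> bv; apply: contrapT => /forallNP h.
  have [|k] := @crossed_seq (children v); last exact: bv.
  move=> w wv; apply: contrapT => /forallNP nk; apply: (h w); split => //.
  split; first by apply/negP => cw; apply: (nk 0%N); rewrite /= cw.
  by move=> k hk; apply: (nk k.+1); rewrite /= hk orbT.
(* Descend to a child that is not cut and below which no depth suffices. *)
pose nx v := xget v [set w | good_step v w].
have nxP v : bad v -> good_step v (nx v).
  by move=> /next[w hw]; rewrite /nx; case: xgetP => [u _ //|/(_ w)].
pose x n := iter n nx root.
have bx n : bad (x n).
  by elim: n => [//|n IH]; rewrite /x iterS; exact: (nxP _ IH).2.2.
have xS i : x i.+1 \in children (x i) := (nxP _ (bx i)).1.
have [_ /(_ x (ray_of_children tree lf erefl xS))[[|i] [[// _ pii] _]]] := cpi.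
have := (nxP _ (bx i)).2.1; rewrite -/(x i.+1) /cut => /negP; apply.
apply/asboolP; move: pii => /=.
have := xS i; rewrite mem_children // => /andP[/eqP xr /eqP px].
by rewrite -{1}px edge_down.
Qed.

(** Lower end points of the first cut edges on the way down from v.  The cutset
    may be infinite, since it may contain edges that lie on no ray; the
    frontier is a finite part of it that suffices. *)
Fixpoint frontier (k : nat) (v : V) : seq V :=
  if cut v then [:: v]
  else if k is k'.+1 then flatten [seq frontier k' w | w <- children v]
  else [::].

Definition root_frontier k := flatten [seq frontier k w | w <- children root].

Lemma mem_frontier k v u : v <> root -> u \in frontier k v ->
  [/\ cut u, u <> root & exists j, iter j parent u = v /\ level u = (level v + j)%N].
Proof.
elim: k v => [|k IH] v vr /=; case: ifP => // cv.
- by rewrite mem_seq1 => /eqP ->; split => //; exists 0%N; rewrite addn0.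
- by rewrite mem_seq1 => /eqP ->; split => //; exists 0%N; rewrite addn0.
move=> /flatten_mapP[w]; rewrite mem_children // => /andP[/eqP wr /eqP pw].
move=> /(IH _ wr)[cu ur [j [ju lj]]]; split => //.
exists j.+1; rewrite iterS ju pw; split => //.
by rewrite lj (level_parent tree wr) pw addSnnS.
Qed.

Lemma frontier_disjoint k v w w' u : w \in children v -> w' \in children v ->
  u \in frontier k w -> u \in frontier k w' -> w = w'.
Proof.
rewrite !mem_children // => /andP[/eqP wr /eqP pw] /andP[/eqP wr' /eqP pw'].
move=> /(mem_frontier wr)[_ _ [j [ju lj]]] /(mem_frontier wr')[_ _ [j' [ju' lj']]].
suff jj : j = j' by rewrite -ju -ju' jj.
move: lj lj'; rewrite (level_parent tree wr) (level_parent tree wr') pw pw'.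
by move=> -> /addnI.
Qed.

Lemma frontier_uniq k v : uniq (frontier k v).
Proof.
elim: k v => [|k IH] v /=; case: ifP => // _.
apply: uniq_flatten_map => //; first exact: children_uniq.
by move=> w w' u wv wv'; exact: (frontier_disjoint (v := v)).
Qed.

Lemma root_frontier_uniq k : uniq (root_frontier k).
Proof.
apply: uniq_flatten_map => [|w _|w w' u wv wv'].
- exact: children_uniq.
- exact: frontier_uniq.
- exact: (frontier_disjoint (v := root)).
Qed.

Lemma mem_root_frontier k u : u \in root_frontier k -> cut u /\ u <> root.
Proof.
move=> /flatten_mapP[w]; rewrite mem_children // => /andP[/eqP wr _].
by move=> /(mem_frontier wr)[].
Qed.

Lemma root_frontier_esum (R : realType) k (g : V * V -> R) :
  (forall e, 0 <= g e) ->
  ((\sum_(u <- root_frontier k) g (parent u, u))%:E <=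
   \esum_(e in pi) (g e)%:E)%E.
Proof.
move=> g0; set s := root_frontier k; apply: esum_ge.
exists [set` [seq (parent u, u) | u <- s]].
  split; first exact: finite_seq.
  move=> e /= /mapP[u us ->].
  by have [/asboolP cu _] := mem_root_frontier us.
rewrite -fsbig_seq; last first.
  by rewrite map_inj_uniq ?root_frontier_uniq // => u v [].
by rewrite big_map sumEFin.
Qed.

End Konig.

Section ParallelPaths.
Context (R : realType) (V : choiceType) (adj : rel V) (root : V).
Context (tree : is_tree adj) (lf : locally_finite adj).
Context (c : V * V -> R) (c_gt0 : forall e, edges adj root e -> 0 < c e).
Local Notation level := (level adj root).
Local Notation parent := (parent adj root).
Local Notation children := (children adj root).
Local Notation up_cond := (up_cond adj root c).
Local Notation branch_cond := (branch_cond adj root c).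
Local Notation branch_sum := (branch_sum adj root c).
Context (pi : set (V * V)).
Local Notation cut := (cut adj root pi).
Local Notation crossed := (crossed adj root pi).
Local Notation frontier := (frontier adj root pi).

Definition ancestry (v : V) : seq V := [seq iter i parent v | i <- iota 0 (level v)].

Lemma ancestry_root : ancestry root = [::].
Proof. by rewrite /ancestry level_root. Qed.

Lemma ancestryE v : v <> root -> ancestry v = v :: ancestry (parent v).
Proof.
move=> vr; rewrite /ancestry (level_parent tree vr) /= -[1%N]addn0 iotaDl -map_comp.
by congr (_ :: _); apply: eq_map => i; rewrite -iterSr.
Qed.

Definition path_resistance v : R := \sum_(u <- ancestry v) (up_cond u)^-1.

Lemma path_resistanceE v : v <> root ->
  path_resistance v = (up_cond v)^-1 + path_resistance (parent v).
Proof. by move=> vr; rewrite /path_resistance ancestryE // big_cons. Qed.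

Lemma mem_ancestry u v : u \in ancestry v -> u <> root.
Proof.
move=> /mapP[i]; rewrite mem_iota add0n => /andP[_ il] ->.
exact: iter_parent_neq.
Qed.

Lemma path_resistance_ge0 v : 0 <= path_resistance v.
Proof.
rewrite /path_resistance big_seq sumr_ge0 // => u /mem_ancestry ur.
by rewrite invr_ge0 ltW // (up_cond_gt0 tree).
Qed.

(** For a conductance s in series with a resistance a, the effective
    conductance is s / (1 + a s). *)
Lemma series_le (a s t : R) : 0 <= a -> 0 <= s -> s <= t ->
  s / (1 + a * s) <= t / (1 + a * t).
Proof.
move=> a0 s0 st; have t0 := le_trans s0 st.
have s1 : 0 < 1 + a * s by rewrite ltr_pwDl // mulr_ge0.
have t1 : 0 < 1 + a * t by rewrite ltr_pwDl // mulr_ge0.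
by rewrite ler_pdivrMr // mulrAC ler_pdivlMr //; nra.
Qed.

(** Giving each of several parallel branches its own copy of the resistance a
    in front of them increases the conductance. *)
Lemma series_sum (a : R) (I : choiceType) (s : seq I) (b : I -> R) : 0 <= a ->
  (forall i, i \in s -> 0 <= b i) ->
  (\sum_(i <- s) b i) / (1 + a * \sum_(i <- s) b i) <=
  \sum_(i <- s) b i / (1 + a * b i).
Proof.
move=> a0 b0; rewrite mulr_suml big_seq [leRHS]big_seq; apply: ler_sum => i si.
rewrite ler_wpM2l ?b0 // lef_pV2 ?posrE ?ltr_pwDl ?mulr_ge0 ?b0 //.
  rewrite lerD2l ler_wpM2l // (perm_big _ (perm_to_rem si)) big_cons lerDl.
  by rewrite big_seq sumr_ge0 // => j /mem_rem; exact: b0.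
by rewrite big_seq sumr_ge0.
Qed.

(** The induction has to carry the resistance of the path above v, in series
    with the branch at v. *)
Lemma branch_cond_le_frontier k v : v <> root -> crossed k v ->
  branch_cond k v / (1 + path_resistance (parent v) * branch_cond k v) <=
  \sum_(u <- frontier k v) (path_resistance u)^-1.
Proof.
(* If the edge above v is cut, bound the branch by that edge alone. *)
have cutcase k' v' : v' <> root ->
    branch_cond k' v' / (1 + path_resistance (parent v') * branch_cond k' v') <=
    (path_resistance v')^-1.
  move=> vr; have U0 := up_cond_gt0 tree c_gt0 vr.
  apply: (le_trans (series_le (path_resistance_ge0 _) (branch_cond_ge0 tree lf c_gt0 k' vr)
    (branch_cond_le tree lf c_gt0 k' vr))).
  rewrite (path_resistanceE vr); have P0 := path_resistance_ge0 (parent v').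
  rewrite ler_pdivrMr ?ltr_pwDl ?mulr_ge0 ?(ltW U0) //.
  rewrite mulrC ler_pdivlMr ?ltr_pwDl ?invr_gt0 //.
  by rewrite mulrDr divff ?lt0r_neq0 // mulrC.
elim: k v => [|k IH] v vr.
  by rewrite /= orbF => ->; rewrite big_seq1; exact: (cutcase 0%N).
rewrite [crossed _ _]/= [frontier _ _]/=; case: ifP => cv /=.
  by rewrite big_seq1 => _; exact: (cutcase k.+1).
move=> /allP cr; rewrite big_flatten big_map /=.
have U0 := up_cond_gt0 tree c_gt0 vr.
have S0 := branch_sum_ge0 tree lf c_gt0 k v.
have P0 := path_resistance_ge0 (parent v).
apply: (@le_trans _ _ (branch_sum k v / (1 + path_resistance v * branch_sum k v))).
  rewrite -!/(branch_sum _ _) (path_resistanceE vr) le_eqVlt; apply/orP; left.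
  set S := branch_sum k v in S0 *; set U := up_cond v in U0 *.
  set P := path_resistance _ in P0 *.
  have h1 : U + S != 0 by rewrite lt0r_neq0 // ltr_wpDr.
  have h2 : U != 0 by rewrite lt0r_neq0.
  have h3 : U + S + P * U * S != 0.
    by rewrite lt0r_neq0 // ltr_wpDr ?mulr_ge0 // ?(ltW U0) // ltr_wpDr.
  apply/eqP.
  have -> : 1 + P * (U * S / (U + S)) = (U + S + P * U * S) / (U + S) by field.
  have -> : 1 + (U^-1 + P) * S = (U + S + P * U * S) / U by field.
  by rewrite !invf_div; field; rewrite h1 h3.
apply: (le_trans (series_sum _ _)); first exact: path_resistance_ge0.
  by move=> w /(child_neq tree lf) wr; exact: branch_cond_ge0.
rewrite big_seq [leRHS]big_seq; apply: ler_sum => w wv.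
rewrite -(parent_child tree lf wv); apply: IH (cr _ wv).
exact: child_neq wv.
Qed.

(** Series and parallel laws: cutting the tree along pi and separating the
    paths to the cut edges can only increase the conductance. *)
Lemma branch_sum_le_frontier k : all (crossed k) (children root) ->
  branch_sum k root <=
  \sum_(u <- root_frontier adj root pi k) (path_resistance u)^-1.
Proof.
move=> /allP cr; rewrite /root_frontier big_flatten big_map /= /branch_sum.
rewrite big_seq [leRHS]big_seq; apply: ler_sum => w wr.
apply: le_trans (branch_cond_le_frontier (child_neq tree lf wr) (cr _ wr)).
rewrite (parent_child tree lf wr) /path_resistance ancestry_root big_nil.
by rewrite mul0r addr0 divr1.
Qed.

End ParallelPaths.

(** * Minimal cuts and flows *)

Section MinCut.
Context (R : realType) (V : choiceType) (adj : rel V) (root : V).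
Context (tree : is_tree adj) (lf : locally_finite adj).
Local Notation level := (level adj root).
Local Notation parent := (parent adj root).
Local Notation children := (children adj root).
Context (q : V -> R) (q_ge0 : forall v, 0 <= q v).

(** Value of the minimal cut, for the capacities q, between the parent of v and
    depth k below v: either cut the edge above v, or cut below each child. *)
Fixpoint mincut (k : nat) (v : V) : R :=
  if k is k'.+1 then Num.min (q v) (\sum_(w <- children v) mincut k' w) else q v.

Definition mincut_sum k v : R := \sum_(w <- children v) mincut k w.

Lemma mincutS k v : mincut k.+1 v = Num.min (q v) (mincut_sum k v).
Proof. by []. Qed.

Lemma mincut_ge0 k v : 0 <= mincut k v.
Proof.
by elim: k v => [|k IH] v /=; rewrite ?q_ge0 // le_min q_ge0 sumr_ge0.
Qed.

Lemma mincut_sum_ge0 k v : 0 <= mincut_sum k v.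
Proof. by apply: sumr_ge0 => w _; exact: mincut_ge0. Qed.

Lemma mincut_le k v : mincut k v <= q v.
Proof. by case: k => [//|k]; rewrite mincutS ge_min lexx. Qed.

(** It is optimal to cut the edge above v.  At depth 0 there is no other
    choice. *)
Definition saturated (k : nat) (v : V) : bool :=
  if k is k'.+1 then q v <= mincut_sum k' v else true.

Fixpoint cut_list (k : nat) (v : V) : seq V :=
  if saturated k v then [:: v]
  else if k is k'.+1 then flatten [seq cut_list k' w | w <- children v]
  else [::].

Lemma sum_cut_list k v : \sum_(u <- cut_list k v) q u = mincut k v.
Proof.
elim: k v => [|k IH] v; first by rewrite /= big_seq1.
rewrite mincutS /=; case: leP => h; first by rewrite big_seq1.
rewrite big_flatten big_map /=; apply: eq_bigr => w _; exact: IH.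
Qed.

Section FixedDepth.
Context (n : nat).

Let sat v := saturated (n - level v) v.

(** The edges of the minimal cut are the first saturated ones on the way down
    from the root. *)
Definition first_saturated (v : V) : Prop :=
  [/\ v <> root, (level v <= n)%N, sat v &
      forall i, (0 < i < level v)%N -> ~~ sat (iter i parent v)].

Definition mincut_set : set (V * V) :=
  [set e | edges adj root e /\ first_saturated e.2].

Lemma cut_list_complete k v j u : (level v + k = n)%N -> iter j parent u = v ->
  (forall i, (i < j)%N -> iter i parent u <> root) ->
  (j <= k)%N -> sat u -> (forall i, (0 < i <= j)%N -> ~~ sat (iter i parent u)) ->
  u \in cut_list k v.
Proof.
elim: k v j => [|k IH] v j lv ju nr jk su ns.
  have j0 : j = 0%N by lia.
  by move: ju; rewrite j0 /= => ->; rewrite inE.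
rewrite [cut_list _ _]/=.
have sv : sat v = (q v <= mincut_sum k v).
  by rewrite /sat (_ : (n - level v)%N = k.+1) //; lia.
case: j ju nr jk ns => [|j] ju nr jk ns.
  by move: su; rewrite /= in ju; rewrite ju sv => ->; rewrite inE.
have := ns j.+1; rewrite ju sv leqnn /= => /(_ isT) /negbTE ->.
set w := iter j parent u.
have wr : w <> root by exact: nr.
have pw : parent w = v by rewrite -ju iterS.
apply/flatten_mapP; exists w.
  by rewrite mem_children // pw eqxx andbT; apply/eqP.
apply: (IH w j) => //.
- by move: lv; rewrite -pw (level_parent tree wr) addSnnS.
- by move=> i ij; apply: nr; exact: ltnW.
- by move=> i /andP[i0 ij]; apply: ns; rewrite i0 ltnW.
Qed.

Lemma first_saturated_mem u : first_saturated u ->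
  u \in flatten [seq cut_list n.-1 w | w <- children root].
Proof.
move=> [ur lu su ns].
have lu0 : (0 < level u)%N by rewrite (level_parent tree ur).
set j := (level u).-1; set w := iter j parent u.
have wr : w <> root by apply: (iter_parent_neq tree); rewrite /j; lia.
have lw : level w = 1%N by rewrite (iter_parent_level tree) /j; lia.
apply/flatten_mapP; exists w.
  rewrite mem_children //; apply/andP; split; first exact/eqP.
  apply/eqP/(level_eq0 tree); have := level_parent tree wr; lia.
apply: (@cut_list_complete _ _ j) => //.
- by rewrite lw; lia.
- by move=> i ij; apply: (iter_parent_neq tree); lia.
- by rewrite /j; lia.
- by move=> i /andP[i0 ij]; apply: ns; rewrite i0 /=; lia.
Qed.

(** Every ray reaches level n, where all vertices are saturated, so it has a
    first saturated vertex. *)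
Lemma mincut_set_cutset : (0 < n)%N -> cutsets adj root mincut_set.
Proof.
move=> n0; split; first by move=> e [].
move=> x rx; have lx i := ray_level tree lf i rx.
have edgeE i : (0 < i)%N -> edge adj root (x i.-1) (x i) = (parent (x i), x i) /\
    x i <> root.
  case: i => [//|i] _ /=; have [h p] := ray_parent tree lf rx i; rewrite p; split => //.
  by rewrite -{1}p edge_down // p.
have ex : exists i, (0 < i)%N && sat (x i).
  by exists n; rewrite n0 /sat lx subnn.
case: (ex_minnP ex) => i /andP[i0 si] mini; exists i; split.
  split => //; rewrite (edgeE _ i0).1; have xr := (edgeE _ i0).2.
  split; first exact: edges_parent; split => //=.
    by rewrite lx; apply: mini; rewrite n0 /sat lx subnn.
  move=> j; rewrite lx => /andP[j0 ji]; rewrite (ray_iter_parent tree lf) ?(ltnW ji) //.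
  apply/negP => sj; have := mini (i - j)%N; rewrite sj andbT; lia.
move=> j [j0]; rewrite (edgeE _ j0).1 => -[_ [_ _ sj nj]]; rewrite /= in sj nj.
have ij : (i <= j)%N by apply: mini; rewrite j0.
apply/eqP; rewrite eqn_leq ij leqNgt /=; apply/negP => lij.
have := nj (j - i)%N; rewrite lx (ray_iter_parent tree lf) // ?leq_subr //.
rewrite (_ : (j - (j - i))%N = i) ?si; last lia.
by move=> h; suff /h : (0 < j - i < j)%N by []; lia.
Qed.

Lemma sum_subset_seq (I : eqType) (s t : seq I) (f : I -> R) : uniq s ->
  {subset s <= t} -> (forall i, 0 <= f i) -> \sum_(i <- s) f i <= \sum_(i <- t) f i.
Proof.
move=> us st f0.
elim: s t us st => [|i s IH] t /=; first by rewrite big_nil sumr_ge0.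
move=> /andP[is_ us] st; have it : i \in t by apply: st; rewrite mem_head.
rewrite big_cons (perm_big _ (perm_to_rem it)) big_cons lerD2l; apply: IH => // j js.
have := st j; rewrite inE js orbT => /(_ isT); rewrite (perm_mem (perm_to_rem it)) inE.
by move=> /orP[/eqP e|//]; rewrite -e js in is_.
Qed.

Lemma mincut_set_esum :
  (\esum_(e in mincut_set) (q e.2)%:E <= (mincut_sum n.-1 root)%:E)%E.
Proof.
apply: ge_ereal_sup => _ [F [finF subF] <-].
rewrite fsbig_finite //= sumEFin lee_fin.
have -> : mincut_sum n.-1 root =
    \sum_(u <- flatten [seq cut_list n.-1 w | w <- children root]) q u.
  rewrite big_flatten big_map /=; apply: eq_bigr => w _.
  by rewrite sum_cut_list.
rewrite -(big_map (fun e : V * V => e.2) xpredT q).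
have memF e : e \in fset_set F -> F e by rewrite in_fset_set // inE.
apply: sum_subset_seq => //.
  rewrite map_inj_in_uniq ?fset_uniq // => e e' /memF/subF[he _] /memF/subF[he' _].
  move=> ee; rewrite (edgesP tree he).2 (edgesP tree he').2.
  by rewrite /= ee.
by move=> u /mapP[e /memF/subF[_ fe] ->]; exact: first_saturated_mem.
Qed.

End FixedDepth.

Lemma mincut_lower_bound (m : R) k :
  (forall pi, cutsets adj root pi -> (m%:E <= \esum_(e in pi) (q e.2)%:E)%E) ->
  m <= mincut_sum k root.
Proof.
move=> H; rewrite -lee_fin; apply: le_trans (mincut_set_esum k.+1).
exact/H/mincut_set_cutset.
Qed.

End MinCut.

Section FlowBound.
Context (R : realType) (V : choiceType) (adj : rel V) (root : V).
Context (tree : is_tree adj) (lf : locally_finite adj).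
Local Notation level := (level adj root).
Local Notation parent := (parent adj root).
Local Notation children := (children adj root).
Context (q : V -> R) (q_ge0 : forall v, 0 <= q v).
Local Notation mincut := (mincut adj root q).
Local Notation mincut_sum := (mincut_sum adj root q).

(** A flow of strength x that enters v is divided among the children in
    proportion to their minimal cuts.  If these are all zero the quotient is
    zero, but then so is x, as long as x does not exceed the minimal cut at v
    (up to a scaling factor eta). *)
Definition subflow k v (x : R) (w : V) : R := x * (mincut k w / mincut_sum k v).

Fixpoint flow_loss (c : V * V -> R) (k : nat) (x : R) (v : V) : R :=
  x * Num.min 1 (x / up_cond adj root c v) +
  if k is k'.+1 then \sum_(w <- children v) flow_loss c k' (subflow k' v x w) w
  else 0.

Lemma subflow_ge0 k v x w : 0 <= x -> 0 <= subflow k v x w.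
Proof.
by move=> x0; rewrite mulr_ge0 // divr_ge0 ?mincut_ge0 ?mincut_sum_ge0.
Qed.

Lemma subflow_le k v x w eta : 0 <= eta -> x <= eta * mincut_sum k v ->
  subflow k v x w <= eta * mincut k w.
Proof.
move=> eta0 xle; rewrite /subflow; have m0 := mincut_ge0 adj root q_ge0 k w.
have := mincut_sum_ge0 adj root q_ge0 k v; rewrite le_eqVlt => /orP[/eqP e|s0].
  by rewrite -e invr0 !mulr0 mulr_ge0.
by rewrite mulrCA mulrC ler_wpM2r // ler_pdivrMr.
Qed.

Lemma sum_subflow k v x eta : 0 <= x -> x <= eta * mincut_sum k v ->
  \sum_(w <- children v) subflow k v x w = x.
Proof.
move=> x0 xle; rewrite /subflow -mulr_sumr -mulr_suml -/(mincut_sum k v).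
have [e|ne] := eqVneq (mincut_sum k v) 0; last by rewrite divff ?mulr1.
by move: xle; rewrite e !mulr0 mul0r => xle; rewrite mulr0; apply/le_anti/andP.
Qed.

Context (c : V * V -> R) (c_gt0 : forall e, edges adj root e -> 0 < c e).
Local Notation up_cond := (up_cond adj root c).
Local Notation branch_cond := (branch_cond adj root c).
Local Notation branch_sum := (branch_sum adj root c).

Lemma flow_loss_ge0 k x v : 0 <= x -> v <> root -> 0 <= flow_loss c k x v.
Proof.
elim: k x v => [|k IH] x v x0 vr;
  have U0 := up_cond_gt0 tree c_gt0 vr;
  have h : 0 <= x * Num.min 1 (x / up_cond v)
    by rewrite mulr_ge0 // le_min ler01 divr_ge0 // ltW.
  by rewrite /= addr0.
rewrite /= addr_ge0 // big_seq sumr_ge0 // => w wv.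
by apply: IH; [exact: subflow_ge0|exact: child_neq wv].
Qed.

(** An edge of conductance U in front of a network that conducts at least x - L:
    in series with U the conductance y = x - L drops by at most
    y^2 / U <= x^2 / U, and for x > U the lower bound is not positive. *)
Lemma series_flow (U S x L : R) : 0 < U -> 0 <= S -> 0 <= x -> 0 <= L ->
  x - L <= S -> x - (x * Num.min 1 (x / U) + L) <= U * S / (U + S).
Proof.
move=> U0 S0 x0 L0 xS; have US : 0 < U + S by rewrite ltr_wpDr.
have R0 : 0 <= U * S / (U + S) by rewrite divr_ge0 ?mulr_ge0 ?(ltW U0) ?(ltW US).
case: (leP 1 (x / U)) => h; first by rewrite mulr1; move: L0 R0; lra.
have [y0|y0] := leP (x - L) 0.
  apply: le_trans R0; apply: le_trans y0; rewrite lerD2l lerN2 lerDr.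
  by rewrite mulr_ge0 // divr_ge0 // ltW.
rewrite opprD addrA addrAC.
apply: (@le_trans _ _ ((x - L) - (x - L) ^+ 2 / U)).
  rewrite lerD2l lerN2 mulrA ler_wpM2r ?invr_ge0 ?(ltW U0) //.
  by rewrite -expr2 ler_pXn2r // ?nnegrE ?(ltW y0) // lerBlDr lerDl.
set y := x - L in xS y0 *.
have -> : y - y ^+ 2 / U = y * (U - y) / U by field; rewrite lt0r_neq0.
rewrite ler_pdivrMr // mulrAC ler_pdivlMr //.
rewrite -subr_ge0; have z0 : 0 <= S - y by rewrite subr_ge0.
have -> : U * S * U - y * (U - y) * (U + S) =
    y ^+ 3 + (S - y) * ((U - y / 2) ^+ 2 + 3 / 4 * y ^+ 2) by field.
have yy : 0 <= y := ltW y0.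
by rewrite addr_ge0 ?exprn_ge0 // mulr_ge0 // addr_ge0 ?sqr_ge0 // mulr_ge0 ?sqr_ge0.
Qed.

(** Every flow bounds the conductance from below, at first order by its
    strength and with a correction of at most x_e min(1, x_e / C_e) for each
    edge e.  The bound is linear in the corrections, so that its mean only
    involves the law of single conductances. *)
Lemma branch_cond_flow k x v eta : 0 <= eta -> 0 <= x -> x <= eta * mincut k v ->
  v <> root -> x - flow_loss c k x v <= branch_cond k v.
Proof.
move=> eta0; elim: k x v => [|k IH] x v x0 xle vr;
    have U0 := up_cond_gt0 tree c_gt0 vr.
  rewrite /= addr0; case: (leP 1 (x / up_cond v)) => h; first by rewrite mulr1 subrr ltW.
  have : x <= up_cond v by move: (ltW h); rewrite ler_pdivrMr // mul1r.
  by apply: le_trans; rewrite lerBlDr lerDl mulr_ge0 // divr_ge0 // ltW.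
have xs : x <= eta * mincut_sum k v.
  by apply: (le_trans xle); rewrite ler_wpM2l // mincutS ge_min lexx orbT.
rewrite branch_condS; apply: series_flow => //.
- exact: branch_sum_ge0.
- by rewrite big_seq sumr_ge0 // => w wv; apply: flow_loss_ge0;
    [exact: subflow_ge0|exact: child_neq wv].
rewrite -{1}(sum_subflow x0 xs) -sumrB /branch_sum big_seq [leRHS]big_seq.
apply: ler_sum => w wv; apply: IH; [exact: subflow_ge0|exact: subflow_le|].
exact: child_neq wv.
Qed.

Lemma branch_sum_flow k x eta : 0 <= eta -> 0 <= x -> x <= eta * mincut_sum k root ->
  x - \sum_(w <- children root) flow_loss c k (subflow k root x w) w
  <= branch_sum k root.
Proof.
move=> eta0 x0 xs; rewrite -{1}(sum_subflow x0 xs) -sumrB /branch_sum.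
rewrite big_seq [leRHS]big_seq; apply: ler_sum => w wv.
apply: (branch_cond_flow eta0); [exact: subflow_ge0|exact: subflow_le|].
exact: child_neq wv.
Qed.

End FlowBound.

(** * Tails of regular variation *)

Section Doubling.
Context (R : realType).
Implicit Types (G L : R -> R) (m t : R).

Lemma dyadic_cover (s t : R) : 0 < s -> exists n, t <= s * 2 ^+ n.
Proof.
move=> s0; exists (Num.bound (t / s)); rewrite -ler_pdivrMl // mulrC.
have [h|h] := leP 0 (t / s).
  have := archi_boundP h => /ltW h'; apply: (le_trans h').
  by rewrite -natrX ler_nat ltnW // ltn_expl.
by apply: (le_trans (ltW h)); rewrite exprn_ge0.
Qed.

(** A power bound that holds on [t0, 2 t0] propagates to all larger t by
    halving. *)
Lemma doubling_upper G m t0 : 0 <= m -> 1 <= t0 -> (forall t, 0 < t -> G t <= 1) ->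
  (forall t, t0 <= t -> G (2 * t) * 2 `^ m <= G t) ->
  exists2 K, 0 < K & forall t, 1 <= t -> G t * t `^ m <= K.
Proof.
move=> m0 t01 G1 dG; have t00 : 0 < t0 by exact: lt_le_trans t01.
exists ((2 * t0) `^ m); first by rewrite powR_gt0 // mulr_gt0.
suff H n t : 1 <= t -> t <= 2 * t0 * 2 ^+ n -> G t * t `^ m <= (2 * t0) `^ m.
  move=> t t1; have [|n hn] := @dyadic_cover (2 * t0) t; first by rewrite mulr_gt0.
  exact: H hn.
elim: n t => [|n IH] t t1 tn; have tp : 0 < t by exact: lt_le_trans t1.
  rewrite mulr1 in tn; apply: (@le_trans _ _ (1 * t `^ m)).
    by rewrite ler_wpM2r ?powR_ge0 // G1.
  by rewrite mul1r ge0_ler_powR ?nnegrE ?mulr_ge0 // ltW.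
have [le2|gt2] := leP t (2 * t0).
  by apply: IH => //; apply: (le_trans le2); rewrite ler_peMr ?mulr_ge0 ?exprn_ege1 ?ler1n // ltW.
have e : t = 2 * (t / 2) by field.
have tt : t0 <= t / 2 by rewrite ler_pdivlMr // mulrC ltW.
have := IH (t / 2); rewrite exprSr mulrA -ler_pdivrMr // in tn.
move=> /(_ (le_trans t01 tt) tn); apply: le_trans.
rewrite [in leLHS]e powRM ?divr_ge0 ?(ltW tp) // mulrA ler_wpM2r ?powR_ge0 //.
exact: dG.
Qed.

Lemma doubling_lower G m t0 : 0 <= m -> 0 < t0 ->
  (forall s t, 0 < s -> s <= t -> G t <= G s) -> 0 < G (2 * t0) ->
  (forall t, t0 <= t -> G t <= G (2 * t) * 2 `^ m) ->
  forall t, t0 <= t -> G (2 * t0) * t0 `^ m <= G t * t `^ m.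
Proof.
move=> m0 t00 mono Gp dG.
suff H n t : t0 <= t -> t <= 2 * t0 * 2 ^+ n -> G (2 * t0) * t0 `^ m <= G t * t `^ m.
  move=> t t1; have [|n hn] := @dyadic_cover (2 * t0) t; first by rewrite mulr_gt0.
  exact: H hn.
elim: n t => [|n IH] t t1 tn; have tp : 0 < t by exact: lt_le_trans t1.
  rewrite mulr1 in tn; rewrite ler_pM ?powR_ge0 ?(ltW Gp) //; first exact: mono.
  by rewrite ge0_ler_powR ?nnegrE // ltW.
have [le2|gt2] := leP t (2 * t0).
  by apply: IH => //; apply: (le_trans le2); rewrite ler_peMr ?mulr_ge0 ?exprn_ege1 ?ler1n // ltW.
have e : t = 2 * (t / 2) by field.
have tt : t0 <= t / 2 by rewrite ler_pdivlMr // mulrC ltW.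
rewrite exprSr mulrA -ler_pdivrMr // in tn.
apply: (le_trans (IH _ tt tn)).
have s0 : 0 <= t / 2 by rewrite divr_ge0 // ltW.
move: (t / 2) e tt s0 {tn t1 gt2 tp} => s -> ts s0.
by rewrite powRM // mulrA ler_wpM2r ?powR_ge0 ?dG.
Qed.

Lemma ltr_powR2 (x y : R) : x < y -> 2 `^ x < 2 `^ y :> R.
Proof.
by move=> xy; rewrite /powR pnatr_eq0 /= ltr_expR ltr_pM2r // ln_gt0 // ltr1n.
Qed.

Section SlowVariation.
Context (L : R -> R) (m : R) (L_sv : slowly_varying L).
Let G t := L t / t `^ m.

Lemma tail_double (t : R) : 0 < t -> L t != 0 ->
  G (2 * t) * 2 `^ m = L (2 * t) / L t * G t.
Proof.
move=> t0 Lt; rewrite /G powRM // ?(ltW t0) //.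
have h1 : t `^ m != 0 by rewrite gt_eqF ?powR_gt0.
have h2 : 2 `^ m != 0 :> R by rewrite gt_eqF ?powR_gt0.
by field; rewrite h1 h2 Lt.
Qed.

Lemma tail_double_eventually (m1 m2 : R) : m1 < m -> m < m2 ->
  exists2 t0, 1 <= t0 & forall t, t0 <= t -> [/\ 0 < G t,
    G (2 * t) * 2 `^ m1 <= G t & G t <= G (2 * t) * 2 `^ m2].
Proof.
move=> m1m mm2; case: L_sv => [[A [_ Lpos]] /(_ 2 (ltr0Sn _ _)) cvgL].
have p1 : (1 : R) < 2 `^ (m - m1) by rewrite -[X in X < _](powRr0 2) ltr_powR2 // subr_gt0.
have p2 : 2 `^ (m - m2) < (1 : R) by rewrite -[X in _ < X](powRr0 2) ltr_powR2 // subr_lt0.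
have [M1 [_ H1]] := cvgr_lt _ cvgL _ p1.
have [M2 [_ H2]] := cvgr_gt _ cvgL _ p2.
exists (Num.max 1 (Num.max A (Num.max (M1 + 1) (M2 + 1)))); first by rewrite le_max lexx.
move=> t; rewrite !ge_max => /and4P[t1 At M1t M2t].
have t0 : 0 < t by exact: lt_le_trans t1.
have Lt := Lpos _ At; have G0 : 0 < G t by rewrite divr_gt0 // powR_gt0.
have Lt0 := lt0r_neq0 Lt.
have /ltW r1 : _ := H1 t (lt_le_trans (ltr_pwDr ltr01 (lexx _)) M1t).
have /ltW r2 : _ := H2 t (lt_le_trans (ltr_pwDr ltr01 (lexx _)) M2t).
have e := tail_double t0 Lt0.
have pm : 0 < 2 `^ m :> R by rewrite powR_gt0.
split=> //.
  rewrite -(ler_pM2r pm) mulrAC e.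
  rewrite powRB ?pnatr_eq0 ?implybT // ler_pdivlMr ?powR_gt0 // in r1.
  by rewrite mulrAC [leRHS]mulrC ler_wpM2r // ltW.
rewrite -(ler_pM2r pm) [leRHS]mulrAC e.
rewrite powRB ?pnatr_eq0 ?implybT // ler_pdivrMr ?powR_gt0 // in r2.
by rewrite [leRHS]mulrAC [leLHS]mulrC ler_wpM2r // ltW.
Qed.

End SlowVariation.

(** With p = g / eps, this is z^p <= exp(z p) for a multiple z of x^eps. *)
Lemma expR_stretched (c eps g : R) : 0 < c -> 0 < eps -> 0 < g ->
  exists2 K, 0 <= K & forall x, 0 < x -> expR (- (c * x `^ eps)) <= K * x `^ (- g).
Proof.
move=> c0 e0 g0; set p := g / eps.
have p0 : 0 < p by rewrite divr_gt0.
exists ((p / c) `^ p); first exact: powR_ge0.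
move=> x x0; rewrite powRN ler_pdivlMr ?powR_gt0 //.
set z := c * x `^ eps / p.
have z0 : 0 < z by rewrite divr_gt0 // mulr_gt0 // powR_gt0.
have -> : x `^ g = (p / c) `^ p * z `^ p.
  rewrite -powRM ?(ltW z0) ?(ltW (divr_gt0 p0 c0)) //.
  have -> : p / c * z = x `^ eps by rewrite /z; field; rewrite !gt_eqF.
  by rewrite -powRrM /p mulrC divfK ?gt_eqF.
rewrite mulrCA -[leRHS]mulr1 ler_wpM2l ?powR_ge0 //.
have -> : c * x `^ eps = z * p by rewrite /z divfK ?gt_eqF.
have : z `^ p <= expR (z * p).
  rewrite expRM ge0_ler_powR ?nnegrE ?(ltW p0) ?(ltW z0) ?expR_ge0 //.
  by apply: le_trans (expR_ge1Dx z); rewrite lerDr.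
by move=> h; rewrite expRN [leLHS]mulrC ler_pdivrMr ?expR_gt0 // mul1r.
Qed.

Lemma powR_ge1 (x g : R) : 1 <= x -> 0 <= g -> 1 <= x `^ g.
Proof. by move=> x1 g0; rewrite -{1}(powRr0 x) ler_powR. Qed.

(** For n independent variables with tail G and sum R, the expression on the
    left bounds E min(1, 1/R): here x is the target size of R and a the
    threshold above which single variables are counted. *)
Definition decay_rate (G : R -> R) (g : R) : Prop :=
  exists2 K, 0 <= K & forall n : nat, (0 < n)%N -> exists a x, [/\ 0 < a, a <= x &
    x^-1 + expR 1 * expR (- (n%:R * (a / x) * G a / 2)) <= K * n%:R `^ (- g)].

(** Threshold a fixed: with positive probability a variable is at least a, so
    their sum is at least of order n, hence of order n^g for g < 1 up to
    stretched exponentially small probability. *)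
Lemma decay_rate_sum (G : R -> R) (g a : R) : 0 < g -> g < 1 -> 0 < a -> 0 < G a ->
  decay_rate G g.
Proof.
move=> g0 g1 a0 Ga.
have [||K K0 HK] := @expR_stretched (G a / 2) (1 - g) g _ _ g0.
- by rewrite divr_gt0.
- by rewrite subr_gt0.
exists (a^-1 + expR 1 * K).
  by rewrite addr_ge0 ?invr_ge0 ?(ltW a0) // mulr_ge0 ?expR_ge0.
move=> n n0; have N0 : 0 < n%:R :> R by rewrite ltr0n.
have N1 : 1 <= n%:R :> R by rewrite ler1n.
exists a, (a * n%:R `^ g); split => //.
  by rewrite ler_peMr ?(ltW a0) // powR_ge1 // ltW.
rewrite [leRHS]mulrDl; apply: lerD; first by rewrite powRN invfM.
rewrite -[leRHS]mulrA ler_wpM2l ?expR_ge0 //.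
apply: le_trans (HK _ N0); rewrite ler_expR lerN2.
have ng : n%:R `^ g != 0 :> R by rewrite gt_eqF ?powR_gt0.
rewrite powRB ?(gt_eqF N0) ?implybT // powRr1 ?(ltW N0) //.
rewrite le_eqVlt; apply/orP; left; apply/eqP.
by field; rewrite ng gt_eqF.
Qed.

(** Threshold a = x of order n^g: the expected number of the n variables above
    it is at least of order n^(1 - m g), a positive power of n. *)
Lemma decay_rate_max (G : R -> R) (g m c t0 : R) : 0 < g -> 0 <= m -> m * g < 1 ->
  0 < t0 -> 0 < c -> (forall t, t0 <= t -> c <= G t * t `^ m) -> decay_rate G g.
Proof.
move=> g0 m0 mg t00 c0 HG.
have [||K K0 HK] := @expR_stretched (c * t0 `^ (- m) / 2) (1 - m * g) g _ _ g0.
- by rewrite divr_gt0 // mulr_gt0 // powR_gt0.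
- by rewrite subr_gt0.
exists (t0^-1 + expR 1 * K).
  by rewrite addr_ge0 ?invr_ge0 ?(ltW t00) // mulr_ge0 ?expR_ge0.
move=> n n0; have N0 : 0 < n%:R :> R by rewrite ltr0n.
have N1 : 1 <= n%:R :> R by rewrite ler1n.
have ng0 : 0 < n%:R `^ g :> R by rewrite powR_gt0.
set x := t0 * n%:R `^ g.
have x0 : 0 < x by rewrite mulr_gt0.
exists x, x; split => //.
rewrite [leRHS]mulrDl; apply: lerD; first by rewrite powRN invfM.
rewrite -[leRHS]mulrA ler_wpM2l ?expR_ge0 //.
apply: le_trans (HK _ N0); rewrite ler_expR lerN2 divff ?gt_eqF // mulr1.
have := HG x; rewrite ler_peMr ?(ltW t00) //; last first.
  by rewrite powR_ge1 // ltW.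
move=> /(_ isT); rewrite -ler_pdivrMr ?powR_gt0 // => h.
apply: (@le_trans _ _ (n%:R * (c / x `^ m) / 2)); last first.
  by rewrite ler_wpM2r ?invr_ge0 // ler_wpM2l // ltW.
rewrite /x powRM ?(ltW t00) ?(ltW ng0) // -powRrM [g * m]mulrC.
rewrite powRB ?(gt_eqF N0) ?implybT // powRr1 ?(ltW N0) // powRN.
have h1 : t0 `^ m != 0 by rewrite gt_eqF ?powR_gt0.
have h2 : n%:R `^ (m * g) != 0 :> R by rewrite gt_eqF ?powR_gt0.
rewrite le_eqVlt; apply/orP; left; apply/eqP.
by field; rewrite h1 h2.
Qed.

(** Decomposition of t over the scales 1 > z > z^2 > ...; it turns tail bounds
    into bounds on truncated means by finite sums. *)
Lemma staircase (z t : R) J : 0 <= z -> t <= 1 ->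
  t <= z ^+ J + \sum_(j < J) z ^+ j * ((z ^+ j.+1 <= t)%R)%:R.
Proof.
move=> z0 t1; elim: J => [|J IH]; first by rewrite big_ord0 addr0.
rewrite big_ord_recr /=; case: (leP (z ^+ J.+1) t) => h; last first.
  rewrite mulr0 addr0 (le_trans (ltW h)) // lerDl sumr_ge0 // => i _.
  by rewrite mulr_ge0 ?exprn_ge0 // ler0n.
rewrite mulr1 (le_trans IH) // addrC lerDr exprn_ge0 //.
Qed.

End Doubling.

(** * Means of functions of the conductances *)

Section Expectation.
Context (R : realType) (d : measure_display) (T : measurableType d)
  (P : probability T R).
Implicit Types f g : T -> R.

Definition expect f : \bar R := (\int[P]_w (f w)%:E)%E.

Lemma measurable_invr f : measurable_fun [set: T] f ->
  measurable_fun [set: T] (fun w => (f w)^-1).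
Proof.
move=> mf.
rewrite (_ : (fun w => (f w)^-1) = fun w => f w * (f w * f w) `^ (-1)).
  apply: measurable_funM => //.
  by apply: (measurableT_comp (measurable_powR (-1))); exact: measurable_funM.
apply/funext => w; rewrite powR_inv1 -?expr2 ?sqr_ge0 //.
have [->|f0] := eqVneq (f w) 0; first by rewrite invr0 mul0r.
by field.
Qed.

Lemma expect_le f g : (forall w, 0 <= f w) -> measurable_fun [set: T] f ->
  measurable_fun [set: T] g -> (forall w, f w <= g w) ->
  (expect f <= expect g)%E.
Proof.
move=> f0 mf mg fg; apply: ge0_le_integral => //.
- by move=> w _; rewrite lee_fin.
- exact/measurable_EFinP.
- exact/measurable_EFinP.
- by move=> w _; rewrite lee_fin.
Qed.

Lemma expect_ge0 f : (forall w, 0 <= f w) -> (0 <= expect f)%E.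
Proof. by move=> f0; apply: integral_ge0 => w _; rewrite lee_fin. Qed.

Lemma expectD f g : (forall w, 0 <= f w) -> measurable_fun [set: T] f ->
  (forall w, 0 <= g w) -> measurable_fun [set: T] g ->
  expect (fun w => f w + g w) = (expect f + expect g)%E.
Proof.
move=> f0 mf g0 mg; rewrite /expect; under eq_integral do rewrite EFinD.
rewrite ge0_integralD //; try exact/measurable_EFinP;
  by move=> w _; rewrite lee_fin.
Qed.

Lemma expectZ (c : R) f : 0 <= c -> (forall w, 0 <= f w) ->
  measurable_fun [set: T] f -> expect (fun w => c * f w) = (c%:E * expect f)%E.
Proof.
move=> c0 f0 mf; rewrite /expect; under eq_integral do rewrite EFinM.
rewrite ge0_integralZl_EFin //; last exact/measurable_EFinP.
by move=> w _; rewrite lee_fin.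
Qed.

Lemma expect_cst (c : R) : expect (fun=> c) = c%:E.
Proof.
rewrite /expect -[LHS]/(\int[P]_w (cst c%:E w))%E integral_cst //.
by rewrite [X in (_ * X)%E]probability_setT mule1.
Qed.

Lemma expect_indic (A : set T) : measurable A -> expect (\1_A) = P A.
Proof. by move=> mA; rewrite /expect integral_indic // setIT. Qed.

Lemma measurable_sum_seq (I : eqType) (s : seq I) (h : I -> T -> R) :
  (forall i, i \in s -> measurable_fun [set: T] (h i)) ->
  measurable_fun [set: T] (fun w => \sum_(i <- s) h i w).
Proof.
elim: s => [|i s IH] mh.
  by under eq_fun do rewrite big_nil; exact: measurable_cst.
under eq_fun do rewrite big_cons; apply: measurable_funD.
  by apply: mh; rewrite mem_head.
by apply: IH => j js; apply: mh; rewrite inE js orbT.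
Qed.

Lemma expect_sum (I : eqType) (s : seq I) (h : I -> T -> R) :
  (forall i, i \in s -> forall w, 0 <= h i w) ->
  (forall i, i \in s -> measurable_fun [set: T] (h i)) ->
  expect (fun w => \sum_(i <- s) h i w) = (\sum_(i <- s) expect (h i))%E.
Proof.
elim: s => [|i s IH] h0 mh.
  rewrite big_nil; under [X in expect X]eq_fun do rewrite big_nil.
  exact: expect_cst.
rewrite big_cons; under [X in expect X]eq_fun do rewrite big_cons.
have h0' j : j \in s -> forall w, 0 <= h j w.
  by move=> js; apply: h0; rewrite inE js orbT.
have mh' j : j \in s -> measurable_fun [set: T] (h j).
  by move=> js; apply: mh; rewrite inE js orbT.
rewrite -(IH h0' mh'); apply: expectD.
- by apply: h0; rewrite mem_head.
- by apply: mh; rewrite mem_head.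
- by move=> w; rewrite big_seq sumr_ge0 // => j js; exact: h0'.
- exact: measurable_sum_seq.
Qed.

End Expectation.

Section TruncatedMean.
Context (R : realType) (d : measure_display) (T : measurableType d)
  (P : probability T R).

(** A fractional moment of order k of 1/Y in disguise.  The staircase has ratio
    z = x^(1/J) for a fixed number J of steps: the step of height z^j is reached
    with probability at most of order z^(m (J - 1 - j)), so since m < 1 each step
    contributes at most z^(m (J - 1)), and J is chosen with k J <= m (J - 1). *)
Lemma truncated_mean (m k K : R) : 0 < k -> k < m -> m < 1 -> 0 <= K ->
  exists2 M, 0 <= M & forall (Y : T -> R), measurable_fun [set: T] Y ->
    (forall w, 0 < Y w) ->
    (forall t : R, 1 <= t -> (P [set w | (Y w <= 1 / t)%R] <= (K / t `^ m)%:E)%E) ->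
    forall x : R, 0 <= x -> x <= 1 ->
    (expect P (fun w => Num.min 1%R (x / Y w)%R) <= (M * x `^ k)%:E)%E.
Proof.
move=> k0 km m1 K0; have m0 : 0 < m by exact: lt_trans km.
(* J >= m / (m - k) is equivalent to k J <= m (J - 1). *)
pose J := (Num.bound (m / (m - k))).+1.
have J0 : (0 < J)%N by [].
have Jk : k * J%:R <= m * (J%:R - 1).
  have : m / (m - k) <= J%:R.
    have h : 0 <= m / (m - k) by rewrite ltW // divr_gt0 // subr_gt0.
    by apply: (le_trans (ltW (archi_boundP h))); rewrite ler_nat.
  by rewrite ler_pdivrMr ?subr_gt0 //; lra.
exists (1 + J%:R * K); first by rewrite addr_ge0 // mulr_ge0.
move=> Y mY Y0 tailY x x0 x1.
have [->|xn0] := eqVneq x 0.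
  rewrite powR0 ?gt_eqF // mulr0 (_ : (fun w => _) = fun=> 0) ?expect_cst //.
  by apply/funext => w; rewrite mul0r; apply/min_idPr.
have xp : 0 < x by rewrite lt_def xn0.
pose z := x `^ J%:R^-1.
have zp : 0 < z by rewrite powR_gt0.
have z1 : z <= 1.
  have -> : 1 = 1 `^ J%:R^-1 :> R by rewrite powR1.
  by rewrite ge0_ler_powR ?nnegrE ?invr_ge0.
have zJ : z ^+ J = x.
  by rewrite -powR_mulrn ?(ltW zp) // -powRrM mulVf ?powRr1 // pnatr_eq0.
have zk : z `^ (k * J%:R) = x `^ k.
  by rewrite -powRrM mulrC mulfK // pnatr_eq0.
pose A (j : 'I_J) := [set w | Y w <= z ^+ (J - j.+1)].
have mA j : measurable (A j).
  rewrite (_ : A j = Y @^-1` `]-oo, z ^+ (J - j.+1)]).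
    by rewrite -[X in measurable X]setTI; exact: mY.
  by apply/seteqP; split => w /=; rewrite in_itv.
pose g w := x + \sum_(j < J) z ^+ j * \1_(A j) w.
have mg : measurable_fun [set: T] g.
  apply: measurable_funD => //; apply: measurable_sum_seq => j _.
  by apply: measurable_funM => //; exact: measurable_indic.
apply: (@le_trans _ _ (expect P g)).
  apply: expect_le => //.
  - by move=> w; rewrite le_min ler01 divr_ge0 // ltW.
  - apply: measurable_minr => //; apply: measurable_funM => //.
    exact: measurable_invr.
  move=> w; set t := Num.min _ _.
  have := @staircase R z t J (ltW zp); rewrite ge_min lexx => /(_ isT)/le_trans; apply.
  rewrite zJ lerD2l; apply: ler_sum => j _; rewrite ler_wpM2l ?exprn_ge0 ?(ltW zp) //.
  case: (leP (z ^+ j.+1) t) => h; last by rewrite ler0n.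
  rewrite indicE mem_set //= /A /=.
  have : z ^+ j.+1 <= x / Y w by apply: (le_trans h); rewrite ge_min lexx orbT.
  rewrite ler_pdivlMr // -zJ -{2}(subnKC (ltn_ord j)) exprD.
  by rewrite ler_pM2l ?exprn_gt0.
have ind0 (j : 'I_J) w : 0 <= z ^+ j * \1_(A j) w by rewrite mulr_ge0 ?exprn_ge0 ?(ltW zp).
have mind (j : 'I_J) : measurable_fun [set: T] (fun w => z ^+ j * \1_(A j) w).
  by apply: measurable_funM => //; exact: measurable_indic.
rewrite /g (@expectD _ _ _ _ (fun=> x)) //; last first.
  - by apply: measurable_sum_seq => j _.
  - by move=> w; rewrite sumr_ge0.
rewrite expect_cst expect_sum //.
have xk : x <= x `^ k by rewrite -{1}(powRr1 x0) ger_powR ?xp ?x1 // ltW // (lt_trans km).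
rewrite [in leRHS]mulrDl mul1r EFinD; apply: leeD; first by rewrite lee_fin.
have term (j : 'I_J) : (expect P (fun w => z ^+ j * \1_(A j) w)%R <= (K * x `^ k)%:E)%E.
  rewrite expectZ; [|by rewrite exprn_ge0 ?(ltW zp)|by move=> w|
    exact: measurable_indic].
  rewrite expect_indic //.
  set n := (J - j.+1)%N; set t := (z ^+ n)^-1.
  have t1 : 1 <= t by rewrite invr_ge1 ?unitfE ?gt_eqF ?exprn_gt0 ?exprn_ile1 // ltW.
  have -> : A j = [set w | Y w <= 1 / t] by rewrite /t div1r invrK.
  apply: (@le_trans _ _ ((z ^+ j)%:E * (K / t `^ m)%:E)%E).
    by rewrite lee_pmul2l ?lte_fin ?exprn_gt0 //; exact: tailY.
  rewrite -EFinM lee_fin mulrCA ler_wpM2l // -zk.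
  have -> : (t `^ m)^-1 = z `^ (m * n%:R).
    rewrite /t -powRN -powR_mulrn ?(ltW zp) // -powRN -!powRrM; congr (_ `^ _); ring.
  rewrite -powR_mulrn ?(ltW zp) // -powRD ?(gt_eqF zp) ?implybT //.
  apply: ger_powR; first by rewrite zp z1.
  have -> : n%:R = J%:R - j%:R - 1 :> R by rewrite /n natrB // -natr1; ring.
  have : 0 <= (1 - m) * j%:R by rewrite mulr_ge0 // subr_ge0 ltW.
  move: Jk; lra.
apply: (@le_trans _ _ (\sum_(j < J) (K * x `^ k)%:E)%E).
  by apply: lee_sum => j _; exact: term.
by rewrite sumEFin sumr_const card_ord lee_fin -mulrA mulr_natl.
Qed.

End TruncatedMean.

(** * Independence and path resistances *)

Section IndependentProduct.
Context (R : realType) (d : measure_display) (T : measurableType d)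
  (P : probability T R) (I : choiceType) (E : set I) (C : I -> {RV P >-> R}).
Context (C_ind : mutually_independent E C).
Context (b p : R) (C_le : forall i, E i -> P [set w | C i w <= b] = p%:E).

Lemma measurable_le_event i : measurable [set w | C i w <= b].
Proof.
rewrite (_ : [set w | _] = C i @^-1` `]-oo, b]).
  by rewrite -[X in measurable X]setTI; exact: measurable_funP.
by apply/seteqP; split => w /=; rewrite in_itv.
Qed.

Let all_gt (s : seq I) := [set w | forall i, i \in s -> b < C i w].

Lemma measurable_all_gt (s : seq I) : measurable (all_gt s).
Proof.
elim: s => [|i s IH].
  by rewrite (_ : all_gt _ = setT) //; apply/seteqP; split.
rewrite (_ : all_gt _ = ~` [set w | C i w <= b] `&` all_gt s).
  by apply: measurableI => //; apply: measurableC; exact: measurable_le_event.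
apply/seteqP; split => w /=.
  move=> h; split; first by apply/negP; rewrite -ltNge h ?mem_head.
  by move=> j js; apply: h; rewrite inE js orbT.
by move=> [/negP]; rewrite -ltNge => h h' j; rewrite inE => /orP[/eqP ->|/h'].
Qed.

Lemma measure_all_gt (s : seq I) : uniq s -> (forall i, i \in s -> E i) ->
  P (all_gt s) = ((1 - p) ^+ size s)%:E.
Proof.
move=> us sE.
have -> : all_gt s = [set w | forall i, i \in s -> `]b, +oo[%classic (C i w)].
  by apply/seteqP; split => w /= h i /h; rewrite in_itv /= andbT.
rewrite (C_ind us sE (B := fun=> `]b, +oo[%classic)) //.
rewrite (_ : (\prod_(i <- s) _)%E = (\prod_(i <- s) (1 - p)%:E)%E); last first.
  apply: eq_big_seq => i /sE Ei.
  have -> : C i @^-1` `]b, +oo[ = ~` [set w | C i w <= b].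
    apply/seteqP; split => w /=; rewrite in_itv /= andbT ltNge; first by move/negP.
    by move=> h; apply/negP.
  by rewrite probability_setC ?C_le //; exact: measurable_le_event.
by rewrite prodEFin big_const_seq count_predT iter_mulr_1.
Qed.

(** Each factor is the mixture (1 - th) + th * 1(C > b), so the mean of the
    product reduces to probabilities of intersections of the events C > b.
    The induction treats the product of some factors with the indicator of such
    an intersection. *)
Lemma expect_product (th : R) : 0 <= th <= 1 ->
  forall s : seq I, uniq s -> (forall i, i \in s -> E i) ->
  measurable_fun [set: T] (fun w => \prod_(i <- s) (1 - th * (C i w <= b)%R%:R)) /\
  expect P (fun w => \prod_(i <- s) (1 - th * (C i w <= b)%R%:R))
    = ((1 - th * p) ^+ size s)%:E.
Proof.
move=> /andP[th0 th1].
pose f (s : seq I) w := \prod_(i <- s) (1 - th * (C i w <= b)%R%:R).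
have f0 s w : 0 <= f s w.
  rewrite /f big_seq prodr_ge0 // => i _.
  by case: (C i w <= b) => /=; rewrite ?mulr1 ?mulr0 ?subr0 ?ler01 // subr_ge0.
have mf s : measurable_fun [set: T] (f s).
  apply: measurable_prod => i _; apply: measurable_funB => //.
  apply: measurable_funM => //.
  rewrite (_ : (fun w => _) = \1_[set w | C i w <= b]).
    exact/measurable_indic/measurable_le_event.
  by apply/funext => w; rewrite indicE; congr (nat_of_bool _)%:R;
     apply/idP/idP => [?|]; rewrite ?inE.
have fS i s w : f (i :: s) w = (1 - th) * f s w + th * (\1_(all_gt [:: i]) w * f s w).
  rewrite {1}/f big_cons -/(f s w).
  have -> : \1_(all_gt [:: i]) w = 1 - (C i w <= b)%R%:R :> R.
    rewrite indicE; case: leP => h.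
      rewrite memNset ?subrr // => /(_ i); rewrite mem_head => /(_ isT).
      by rewrite ltNge h.
    by rewrite mem_set ?subr0 // => j; rewrite inE => /eqP ->.
  ring.
have main s s' : uniq (s' ++ s) -> (forall i, i \in s' ++ s -> E i) ->
    expect P (fun w => \1_(all_gt s') w * f s w) =
    ((1 - p) ^+ size s' * (1 - th * p) ^+ size s)%:E.
  elim: s s' => [|i s IH] s'.
    rewrite cats0 => us sE; rewrite mulr1 -(measure_all_gt us sE).
    rewrite -(expect_indic P (measurable_all_gt s')); congr (expect _ _).
    by apply/funext => w; rewrite /f big_nil mulr1.
  move=> us sE.
  have us2 : uniq ((i :: s') ++ s) by rewrite -[_ ++ _]/([:: i] ++ s' ++ s) uniq_catCA.
  have us' : uniq (s' ++ s) by case/andP: us2.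
  have g0 s1 w : 0 <= \1_(all_gt s1) w * f s w by rewrite mulr_ge0.
  have mg s1 : measurable_fun [set: T] (fun w => \1_(all_gt s1) w * f s w).
    by apply: measurable_funM => //; apply: measurable_indic; exact: measurable_all_gt.
  rewrite (_ : (fun w => _) = fun w => (1 - th) * (\1_(all_gt s') w * f s w) +
     th * (\1_(all_gt (i :: s')) w * f s w)).
    rewrite expectD; [|by move=> w; rewrite mulr_ge0 ?subr_ge0|
      exact: measurable_funM|by move=> w; rewrite mulr_ge0|exact: measurable_funM].
    rewrite !expectZ ?subr_ge0 // IH //; last first.
      by move=> j; rewrite mem_cat => js; apply: sE; rewrite mem_cat inE;
        case/orP: js => ->; rewrite ?orbT.
    rewrite IH //; last first.
      move=> j; rewrite /= inE mem_cat => js; apply: sE; rewrite mem_cat inE.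
      by case/or3P: js => ->; rewrite ?orbT.
    by rewrite -!EFinM -EFinD; congr (_%:E); rewrite /= !exprS; ring.
  apply/funext => w; rewrite fS mulrDr mulrCA; congr (_ + _).
  rewrite mulrCA; congr (_ * _); rewrite mulrA; congr (_ * _).
  rewrite -[LHS]/((\1_(all_gt s') \* \1_(all_gt [:: i])) w) -indicI.
  congr (\1_ _ _); apply/seteqP; split => u /=.
    move=> [h h'] j; rewrite inE => /orP[/eqP ->|]; last exact: h.
    by apply: h'; rewrite mem_head.
  move=> h; split => j js; apply: h; rewrite inE ?js ?orbT //.
  by move: js; rewrite inE => ->.
move=> s us sE; split; first exact: mf.
have := main s [::] us sE; rewrite expr0 mul1r => <-; congr (expect _ _).
apply/funext => w; rewrite indicE mem_set ?mul1r //.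
Qed.

End IndependentProduct.

Section PathEstimate.
Context (R : realType) (V : choiceType) (adj : rel V) (root : V).
Context (tree : is_tree adj) (lf : locally_finite adj).
Local Notation level := (level adj root).
Local Notation parent := (parent adj root).
Local Notation ancestry := (ancestry adj root).

Definition path_edges (v : V) : seq (V * V) :=
  [seq (parent u, u) | u <- ancestry v].

Lemma size_path_edges v : size (path_edges v) = level v.
Proof. by rewrite !size_map size_iota. Qed.

Lemma path_edges_edges v e : e \in path_edges v -> edges adj root e.
Proof. by move=> /mapP[u /(mem_ancestry tree) ur ->]; exact: edges_parent. Qed.

Lemma path_edges_uniq v : uniq (path_edges v).
Proof.
rewrite map_inj_uniq; last by move=> u u' [].
rewrite map_inj_in_uniq ?iota_uniq // => i j; rewrite !mem_iota !add0n.
move=> /andP[_ il] /andP[_ jl] e.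
have := iter_parent_level tree (ltnW il); rewrite e.
by rewrite (iter_parent_level tree (ltnW jl)); lia.
Qed.

Lemma path_resistance_edges (c : V * V -> R) v :
  path_resistance adj root c v = \sum_(e <- path_edges v) (c e)^-1.
Proof. by rewrite big_map. Qed.

Definition hit_bound (x th b : R) (s : seq (V * V)) (c : V * V -> R) : R :=
  x^-1 + expR 1 * \prod_(e <- s) (1 - th * (c e <= b)%R%:R).

(** Either the resistance is at least x, or exp(1 - R/x) is at least 1; the
    exponential splits over the edges, and each factor is bounded by a step
    function of the conductance. *)
Lemma hit_bound_ge (a x : R) (s : seq (V * V)) (c : V * V -> R) :
  0 < a -> a <= x -> (forall e, e \in s -> 0 < c e) ->
  Num.min 1 (\sum_(e <- s) (c e)^-1)^-1 <=
  hit_bound x (a / x / (1 + a / x)) a^-1 s c.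
Proof.
move=> a0 ax c0; have x0 : 0 < x by exact: lt_le_trans ax.
set y := a / x; have y0 : 0 < y by rewrite divr_gt0.
set th := y / (1 + y); have y1 : 0 < 1 + y by rewrite addr_gt0.
have th1 : 1 - th = (1 + y)^-1 by rewrite /th; field; rewrite gt_eqF.
set S := \sum_(e <- s) _.
have S0 : 0 <= S by rewrite /S big_seq sumr_ge0 // => e /c0/ltW; rewrite invr_ge0.
have prod_ge0 : 0 <= \prod_(e <- s) (1 - th * (c e <= a^-1)%R%:R).
  rewrite big_seq prodr_ge0 // => e _.
  by case: (c e <= a^-1); rewrite ?mulr1 ?mulr0 ?subr0 ?ler01 // th1 invr_ge0 ltW.
have [xS|Sx] := leP x S.
  apply: (@le_trans _ _ x^-1); last by rewrite lerDl mulr_ge0 ?expR_ge0.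
  by rewrite ge_min lef_pV2 ?posrE ?xS ?orbT // (lt_le_trans x0).
rewrite ge_min; apply/orP; left.
apply: (@le_trans _ _ (expR 1 * expR (- (S / x)))).
  rewrite -expRD -[leLHS]expR0 ler_expR subr_ge0 ler_pdivrMr // mul1r ltW //.
apply: (@le_trans _ _ (expR 1 * \prod_(e <- s) (1 - th * (c e <= a^-1)%R%:R))); last first.
  by rewrite lerDr invr_ge0 ltW.
rewrite ler_wpM2l ?expR_ge0 //.
rewrite /S mulr_suml -sumrN expR_sum big_seq [leRHS]big_seq; apply: ler_prod => e es.
rewrite expR_ge0 /=; case: (leP (c e) a^-1) => h; last first.
  rewrite mulr0 subr0 -expR0 ler_expR oppr_le0 divr_ge0 ?(ltW x0) //.
  by rewrite invr_ge0 ltW ?c0.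
rewrite mulr1 th1 expRN lef_pV2 ?posrE ?expR_gt0 //.
apply: (le_trans (expR_ge1Dx _)); rewrite ler_expR ler_wpM2r ?invr_ge0 ?(ltW x0) //.
by rewrite -[a]invrK lef_pV2 ?posrE ?invr_gt0 // c0.
Qed.

Context (d : measure_display) (Omega : measurableType d) (P : probability Omega R).
Context (C : V * V -> {RV P >-> R}).
Context (C_ind : mutually_independent (edges adj root) C).
Context (G : R -> R) (C_tail : forall e, edges adj root e -> forall t, 0 < t ->
  P [set w | C e w <= 1 / t] = (G t)%:E).

Lemma measurable_hit_bound x th b s :
  measurable_fun [set: Omega] (fun w => hit_bound x th b s (fun e => C e w)).
Proof.
apply: measurable_funD => //; apply: measurable_funM => //.
apply: measurable_prod => i _; apply: measurable_funB => //.
apply: measurable_funM => //.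
rewrite (_ : (fun w => _) = \1_[set w | C i w <= b]).
  apply: measurable_indic; exact: measurable_le_event.
by apply/funext => w; rewrite indicE; congr (nat_of_bool _)%:R;
   apply/idP/idP => [?|]; rewrite ?inE.
Qed.

(** By independence the mean of the product is (1 - th G(a))^n, at most
    exp(- n th G(a)), and th is at least a / (2 x). *)
Lemma expect_hit_bound (a x : R) v : 0 < a -> a <= x -> 0 <= G a <= 1 ->
  (expect P (fun w => hit_bound x (a / x / (1 + a / x)) a^-1 (path_edges v)
     (fun e => C e w)) <=
   (x^-1 + expR 1 * expR (- ((level v)%:R * (a / x) * G a / 2)))%:E)%E.
Proof.
move=> a0 ax /andP[G0 G1]; have x0 : 0 < x by exact: lt_le_trans ax.
set y := a / x; have y0 : 0 < y by rewrite divr_gt0.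
have y1 : y <= 1 by rewrite ler_pdivrMr // mul1r.
set th := y / (1 + y); have y2 : 0 < 1 + y by rewrite addr_gt0.
have th0 : 0 <= th by rewrite divr_ge0 ?ltW.
have th1 : th <= 1 by rewrite ler_pdivrMr // mul1r lerDr.
have Ca e : edges adj root e -> P [set w | C e w <= a^-1] = (G a)%:E.
  by move=> he; rewrite -(C_tail he a0) div1r.
have th01 : 0 <= th <= 1 by rewrite th0.
have [mprod Eprod] := expect_product C_ind Ca th01 (path_edges_uniq v)
  (@path_edges_edges v).
have prod_ge0 w : 0 <= \prod_(e <- path_edges v) (1 - th * (C e w <= a^-1)%R%:R).
  rewrite big_seq prodr_ge0 // => e _.
  by case: (C e w <= a^-1); rewrite ?mulr1 ?mulr0 ?subr0 ?ler01 // subr_ge0.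
rewrite /hit_bound expectD; [|by move=> w; rewrite invr_ge0 ltW|by []|
  by move=> w; rewrite mulr_ge0 ?expR_ge0|exact: measurable_funM].
rewrite expect_cst expectZ ?expR_ge0 // Eprod size_path_edges -EFinM -EFinD lee_fin.
rewrite lerD2l ler_wpM2l ?expR_ge0 //.
have -> : - ((level v)%:R * y * G a / 2) = (level v)%:R * - (y / 2 * G a) by ring.
rewrite expRM_natl lerXn2r ?nnegrE ?expR_ge0 //.
  by rewrite subr_ge0 mulr_ile1.
apply: (le_trans _ (expR_ge1Dx _)); rewrite lerD2l lerN2 ler_wpM2r //.
by rewrite /th ler_wpM2l ?(ltW y0) // lef_pV2 ?posrE //; lra.
Qed.

End PathEstimate.

(** * Expected loss of a flow *)

Section ExpectedLoss.
Context (R : realType).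

(** Comparison of n^-(1+del) with the increment of its primitive; with b = n + 1
    this is ln (b / (b - 1)) >= 1 / b. *)
Lemma powR_telescope (del : R) (n : nat) : 0 < del -> (0 < n)%N ->
  n.+1%:R `^ (- (1 + del)) <= del^-1 * (n%:R `^ (- del) - n.+1%:R `^ (- del)).
Proof.
move=> d0 n0; set a : R := n%:R; set b : R := n.+1%:R.
have a0 : 0 < a by rewrite ltr0n.
have b0 : 0 < b by rewrite ltr0n.
have ab : a = b - 1 by rewrite /a /b -natr1 addrK.
rewrite ler_pdivlMl //.
have -> : b `^ (- (1 + del)) = b^-1 * b `^ (- del).
  by rewrite opprD powRD ?(gt_eqF b0) ?implybT // powR_inv1 // ltW.
have -> : a `^ (- del) = b `^ (- del) * expR (del * ln (b / a)).
  rewrite /powR (gt_eqF a0) (gt_eqF b0) -expRD lnM ?posrE ?invr_gt0 // lnV ?posrE //.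
  by congr expR; ring.
have lnb : b^-1 <= ln (b / a).
  rewrite -lerN2 -lnV ?posrE ?divr_gt0 // invf_div.
  have -> : a / b = 1 + - b^-1 by rewrite ab; field; rewrite gt_eqF.
  by apply: le_ln1Dx; rewrite ltrN2 invf_lt1 // /b ltr1n ltnS.
rewrite mulrA [leLHS]mulrC -[X in _ - X]mulr1 -mulrBr ler_wpM2l ?powR_ge0 //.
by rewrite lerBrDr addrC (le_trans _ (expR_ge1Dx _)) // lerD2l ler_pM2l.
Qed.

(** Upper bound for the sum of j^-(1+del) over j >= n, in the form that is
    propagated by [zeta_tail_step]. *)
Definition zeta_tail (del : R) (n : nat) : R :=
  n%:R `^ (- (1 + del)) + del^-1 * n%:R `^ (- del).

Lemma zeta_tail_step (del : R) (n : nat) : 0 < del -> (0 < n)%N ->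
  n%:R `^ (- (1 + del)) + zeta_tail del n.+1 <= zeta_tail del n.
Proof.
move=> d0 n0; rewrite /zeta_tail lerD2l -lerBrDr -mulrBr; exact: powR_telescope.
Qed.

Lemma zeta_tail_ge0 del n : 0 < del -> 0 <= zeta_tail del n.
Proof. by move=> d0; rewrite addr_ge0 ?powR_ge0 // mulr_ge0 ?powR_ge0 // invr_ge0 ltW. Qed.

Context (V : choiceType) (adj : rel V) (root : V).
Context (tree : is_tree adj) (lf : locally_finite adj).
Local Notation level := (level adj root).
Local Notation parent := (parent adj root).
Local Notation children := (children adj root).
Context (d : measure_display) (Omega : measurableType d) (P : probability Omega R).
Context (C : V * V -> {RV P >-> R}).
Context (C_gt0 : forall e, edges adj root e -> forall w, 0 < C e w).
Context (g k M eta del : R) (g0 : 0 < g) (k0 : 0 < k) (M0 : 0 <= M)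
  (eta0 : 0 < eta) (eta1 : eta <= 1) (d0 : 0 < del) (gk : g * k = 1 + del).
Context (C_mean : forall e, edges adj root e -> forall x : R, 0 <= x -> x <= 1 ->
  (expect P (fun w => Num.min 1%R (x / C e w)%R) <= (M * x `^ k)%:E)%E).

Definition level_weight (v : V) : R := (level v)%:R `^ (- g).

Lemma level_weight_ge0 v : 0 <= level_weight v.
Proof. exact: powR_ge0. Qed.

Lemma level_weight_le1 v : v <> root -> level_weight v <= 1.
Proof.
move=> vr; rewrite /level_weight powRN invf_le1 ?powR_ge1 ?ler1n ?ltW //.
  by rewrite (level_parent tree vr).
by rewrite powR_gt0 // ltr0n (level_parent tree vr).
Qed.

Local Notation q := level_weight.
Local Notation loss := (fun n x v w => flow_loss adj root q (fun e => C e w) n x v).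

Lemma measurable_flow_loss n x v : v <> root -> measurable_fun [set: Omega] (loss n x v).
Proof.
elim: n x v => [|n IH] x v vr; apply: measurable_funD => //.
- apply: measurable_funM => //; apply: measurable_minr => //.
  by apply: measurable_funM => //; apply: measurable_invr; exact: measurable_funP.
- apply: measurable_funM => //; apply: measurable_minr => //.
  by apply: measurable_funM => //; apply: measurable_invr; exact: measurable_funP.
apply: measurable_sum_seq => u uv; apply: IH; exact: child_neq uv.
Qed.

Lemma flow_loss_pos n x v w : 0 <= x -> v <> root -> 0 <= loss n x v w.
Proof.
by move=> x0 vr; apply: flow_loss_ge0 => //; [exact: level_weight_ge0 | move=> e /C_gt0].
Qed.

Lemma expect_edge_loss x v : v <> root -> 0 <= x -> x <= eta * q v ->
  (expect P (fun w => x * Num.min 1 (x / up_cond adj root (fun e => C e w) v))%R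
    <= (x * (M * eta `^ k * (level v)%:R `^ (- (1 + del))))%:E)%E.
Proof.
move=> vr x0 xq.
have x1 : x <= 1.
  by apply: (le_trans xq); rewrite mulr_ile1 ?level_weight_ge0 ?level_weight_le1 // ltW.
have C0 w : 0 < C (parent v, v) w by apply: C_gt0; exact: edges_parent.
pose f w := Num.min 1 (x / up_cond adj root (fun e => C e w) v).
have f0 w : 0 <= f w by rewrite le_min ler01 divr_ge0 // ltW // C0.
have mf : measurable_fun [set: Omega] f.
  apply: measurable_minr => //; apply: measurable_funM => //.
  by apply: measurable_invr; exact: measurable_funP.
rewrite (expectZ P x0 f0 mf).
rewrite EFinM lee_wpmul2l ?lee_fin //.
apply: le_trans (C_mean (edges_parent tree vr) x0 x1) _; rewrite lee_fin.
rewrite -mulrA ler_wpM2l // -gk -mulNr powRrM -powRM ?powR_ge0 ?(ltW eta0) //.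
by rewrite ge0_ler_powR ?nnegrE ?mulr_ge0 ?level_weight_ge0 ?(ltW eta0) ?(ltW k0).
Qed.

(** Since x_e <= eta |e|^-g, an edge at level n loses on average at most
    M x_e (eta n^-g)^k; the x_e add up to x on each level, and the exponents
    g k = 1 + del are summable over the levels. *)
Lemma expect_flow_loss n x v : v <> root -> 0 <= x -> x <= eta * mincut adj root q n v ->
  (expect P (loss n x v) <= (x * (M * eta `^ k * zeta_tail del (level v)))%:E)%E.
Proof.
set A := M * eta `^ k; have A0 : 0 <= A by rewrite mulr_ge0 ?powR_ge0.
have C0 u w : u <> root -> 0 < up_cond adj root (fun e => C e w) u.
  by move=> ur; apply: C_gt0; exact: edges_parent.
elim: n x v => [|n IH] x v vr x0 xle;
  have lv : (0 < level v)%N by [rewrite (level_parent tree vr)];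
  have xq : x <= eta * q v by
    [apply: (le_trans xle); rewrite ler_wpM2l ?(ltW eta0) ?mincut_le].
  rewrite (_ : loss 0 x v = fun w =>
    x * Num.min 1 (x / up_cond adj root (fun e => C e w) v)); last first.
    by apply/funext => w /=; rewrite addr0.
  apply: (le_trans (expect_edge_loss vr x0 xq)).
  rewrite lee_fin ler_wpM2l // ler_wpM2l // lerDl mulr_ge0 ?powR_ge0 //.
  by rewrite invr_ge0 ltW.
have m1 : measurable_fun [set: Omega] (fun w =>
    x * Num.min 1 (x / up_cond adj root (fun e => C e w) v)).
  apply: measurable_funM => //; apply: measurable_minr => //.
  apply: measurable_funM => //; apply: measurable_invr; exact: measurable_funP.
have xs : x <= eta * mincut_sum adj root q n v.
  by apply: (le_trans xle); rewrite ler_wpM2l ?(ltW eta0) // mincutS ge_min lexx orbT.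
have sub0 w : 0 <= subflow adj root q n v x w.
  by apply: subflow_ge0 => //; exact: level_weight_ge0.
rewrite expectD //; first last.
- by apply: measurable_sum_seq => u uv; apply: measurable_flow_loss; exact: child_neq uv.
- move=> w; rewrite big_seq sumr_ge0 // => u uv.
  by apply: flow_loss_pos => //; exact: child_neq uv.
- by move=> w; rewrite mulr_ge0 // le_min ler01 divr_ge0 // ltW // C0.
rewrite expect_sum; first last.
- by move=> u uv; apply: measurable_flow_loss; exact: child_neq uv.
- by move=> u uv w; apply: flow_loss_pos => //; exact: child_neq uv.
have H : (\sum_(u <- children v) expect P (loss n (subflow adj root q n v x u) u) <=
    (x * (A * zeta_tail del (level v).+1))%:E)%E.
  rewrite -{2}(sum_subflow x0 xs) mulr_suml -sumEFin.
  rewrite big_seq [leRHS]big_seq; apply: lee_sum => u uv.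
  have ur := child_neq tree lf uv.
  have -> : (level v).+1 = level u.
    by rewrite (level_parent tree ur) (parent_child tree lf uv).
  apply: IH => //; apply: subflow_le xs => //; [exact: level_weight_ge0|exact: ltW].
apply: (le_trans (leeD (expect_edge_loss vr x0 xq) H)).
rewrite -EFinD lee_fin -mulrDr ler_wpM2l // -mulrDr ler_wpM2l //.
exact: zeta_tail_step.
Qed.

End ExpectedLoss.

(** * Return probabilities of the random walk on random conductances *)

Section RandomWalk.
Context (R : realType) (V : choiceType) (adj : rel V) (root : V).
Context (tree : is_tree adj) (lf : locally_finite adj) (Vinf : infinite_set [set: V]).
Context (dO dW : measure_display) (Omega : measurableType dO) (P : probability Omega R).
Context (C : V * V -> {RV P >-> R}).
Context (C_gt0 : forall e, edges adj root e -> forall w, 0 < C e w).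
Context (W : measurableType dW) (Q : R.-pker Omega ~> W) (X : nat -> W -> V).
Context (X_walk : is_rwrc adj root C Q X).
Local Notation level := (level adj root).
Local Notation parent := (parent adj root).
Local Notation children := (children adj root).
Local Notation cond w := (fun e => C e w).
Local Notation never := [set w | return_time R X root w = +oo%E].
Local Notation avoiding N := (no_hit X root 0 N.+1).

Let cond_gt0 w : forall e, edges adj root e -> 0 < C e w.
Proof. by move=> e /C_gt0. Qed.

Lemma quenched_no_return w N :
  Q w (avoiding N) = (no_return adj root (cond w) N)%:E.
Proof.
have H := @measure_no_return R V _ W (Q w) (@prob_kernel _ _ _ _ _ Q w) X root _ (X_walk w)
  (neighbours adj root) (neighbours_uniq root tree lf)
  (sum_transition1 tree lf (cond_gt0 w) Vinf)
  (avoid adj root (cond w)) (avoid_root _ _ _) (avoid0 _ _) (avoidS _ _) N.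
exact: H.
Qed.

Lemma measurable_avoiding N : measurable (avoiding N).
Proof. exact: measurable_no_hit (X_walk point) _ _. Qed.

Lemma measurable_never : measurable never.
Proof. exact: measurable_return_time_infty (X_walk point). Qed.

Lemma never_avoiding N : never `<=` avoiding N.
Proof. by rewrite return_time_infty => w h; exact: h. Qed.

Lemma quenched_never_le1 w : (Q w never <= 1)%E.
Proof.
rewrite -(@prob_kernel _ _ _ _ _ Q w); apply: le_measure; rewrite ?inE //.
exact: measurable_never.
Qed.

Lemma quenched_never_fin w : Q w never \is a fin_num.
Proof. by rewrite ge0_fin_numE // (le_lt_trans (quenched_never_le1 w)) ?ltry. Qed.

Lemma quenched_never_le w k : (Q w never <=
  (branch_sum adj root (cond w) k root / total_cond adj root (cond w) root)%:E)%E.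
Proof.
rewrite -(fineK (quenched_never_fin w)) lee_fin.
apply: (no_return_le tree lf (cond_gt0 w) Vinf) => N.
rewrite -lee_fin fineK ?quenched_never_fin // -quenched_no_return.
apply: le_measure; rewrite ?inE; [exact: measurable_never|exact: measurable_avoiding|].
exact: never_avoiding.
Qed.

Lemma quenched_no_return_ge w N :
  branch_sum adj root (cond w) N root / total_cond adj root (cond w) root <=
  no_return adj root (cond w) N.
Proof. exact: no_return_ge (cond_gt0 w) Vinf N. Qed.

Lemma measurable_no_return N :
  measurable_fun [set: Omega] (fun w => no_return adj root (cond w) N).
Proof.
apply/measurable_EFinP.
have := measurable_kernel Q _ (measurable_avoiding N).
by congr measurable_fun; apply/funext => w; rewrite quenched_no_return.
Qed.

Lemma no_return_ge0 w N : 0 <= no_return adj root (cond w) N.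
Proof. by rewrite -lee_fin -quenched_no_return. Qed.

Lemma no_return_le1 w N : no_return adj root (cond w) N <= 1.
Proof.
rewrite -lee_fin -quenched_no_return -(@prob_kernel _ _ _ _ _ Q w).
by apply: le_measure; rewrite ?inE //; exact: measurable_avoiding.
Qed.

(** Continuity from above, under the quenched and then the annealed law. *)
Lemma annealed_never_ge (a : R) :
  (forall N, (a%:E <= expect P (fun w => no_return adj root (cond w) N))%E) ->
  (a%:E <= annealed P Q never)%E.
Proof.
move=> H; rewrite /annealed.
have cvgQ w : (no_return adj root (cond w) n)%:E @[n --> \oo] --> Q w never.
  have E : (fun n => (no_return adj root (cond w) n)%:E) = Q w \o (fun N => avoiding N).
    by apply/funext => n /=; rewrite quenched_no_return.
  rewrite E return_time_infty; apply: nonincreasing_cvg_mu.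
  - by rewrite [X in (X < _)%E]quenched_no_return ltry.
  - by move=> i; exact: measurable_avoiding.
  - by rewrite -(return_time_infty R); exact: measurable_never.
  move=> i j ij; apply/subsetPset => u h l /andP[l0 lj]; apply: h.
  by rewrite l0 (leq_trans lj) // !add0n ltnS.
have mf n : measurable_fun [set: Omega] (fun w => (no_return adj root (cond w) n)%:E).
  exact/measurable_EFinP/measurable_no_return.
have mQ := measurable_kernel Q _ measurable_never.
have pt : \forall w \ae P, [set: Omega] w ->
    (no_return adj root (cond w) n)%:E @[n --> \oo] --> Q w never.
  by apply: aeW => w _; exact: cvgQ.
have bnd : \forall w \ae P, forall n, [set: Omega] w ->
    (`|(no_return adj root (cond w) n)%:E| <= (EFin \o cst 1%R) w)%E.
  by apply: aeW => w n _; rewrite /= lee_fin ger0_norm ?no_return_ge0 ?no_return_le1.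
have [_ _ cvgI] := dominated_convergence measurableT mf mQ pt
  (finite_measure_integrable_cst P 1 measurableT) bnd.
by apply: (cvge_to_ge cvgI); apply: nearW => n; exact: H.
Qed.

End RandomWalk.

(** * Recurrence *)

Lemma min_sum_le (R : realType) (I : eqType) (s : seq I) (a : I -> R) :
  (forall i, i \in s -> 0 <= a i) ->
  Num.min 1 (\sum_(i <- s) a i) <= \sum_(i <- s) Num.min 1 (a i).
Proof.
elim: s => [|i s IH] a0; first by rewrite !big_nil ge_min lexx orbT.
rewrite !big_cons; have ai : 0 <= a i by rewrite a0 ?mem_head.
have a0' j : j \in s -> 0 <= a j by move=> js; rewrite a0 // inE js orbT.
have S0 : 0 <= \sum_(j <- s) a j by rewrite big_seq sumr_ge0.
have := IH a0'; set S := \sum_(j <- s) a j in S0 *; set T := \sum_(j <- s) _.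
by rewrite !minEle; case: ifP; case: ifP; case: ifP => //; lra.
Qed.

Section Recurrence.
Context (R : realType) (V : choiceType) (adj : rel V) (root : V).
Context (tree : is_tree adj) (lf : locally_finite adj) (Vinf : infinite_set [set: V]).
Context (dO dW : measure_display) (Omega : measurableType dO) (P : probability Omega R).
Context (C : V * V -> {RV P >-> R}).
Context (C_ind : mutually_independent (edges adj root) C).
Context (C_gt0 : forall e, edges adj root e -> forall w, 0 < C e w).
Context (G : R -> R) (C_tail : forall e, edges adj root e -> forall t, 0 < t ->
  P [set w | C e w <= 1 / t] = (G t)%:E).
Context (W : measurableType dW) (Q : R.-pker Omega ~> W) (X : nat -> W -> V).
Context (X_walk : is_rwrc adj root C Q X).
Local Notation level := (level adj root).
Local Notation parent := (parent adj root).
Local Notation children := (children adj root).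
Local Notation cond w := (fun e => C e w).
Local Notation never := [set w | return_time R X root w = +oo%E].

Lemma root_child : exists w, w \in children root.
Proof.
have := children_root_neq0 root tree lf Vinf.
by case: (children root) => // w s _; exists w; rewrite mem_head.
Qed.

Lemma tail_bounds t : 0 < t -> 0 <= G t <= 1.
Proof.
move=> t0; have [v /(child_neq tree lf) vr] := root_child.
have E := C_tail (edges_parent tree vr) t0.
rewrite -!lee_fin -E probability_le1 ?andbT //.
exact: measurable_le_event.
Qed.

Lemma tail_nonincreasing s t : 0 < s -> s <= t -> G t <= G s.
Proof.
move=> s0 st; have t0 := lt_le_trans s0 st.
have [v /(child_neq tree lf) vr] := root_child.
have he := edges_parent tree vr.
rewrite -lee_fin -(C_tail he t0) -(C_tail he s0).
apply: le_measure; rewrite ?inE; [exact: measurable_le_event..|].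
by move=> w /= /le_trans; apply; rewrite !div1r lef_pV2.
Qed.

Lemma annealed_expect :
  annealed P Q never = expect P (fun w => fine (Q w never)).
Proof.
rewrite /annealed /expect; apply: eq_integral => w _.
by rewrite fineK //; exact: quenched_never_fin X_walk w.
Qed.

(** The mean of S / T is not under control where the total conductance T at the
    root is small; this costs the probability G(1/del) that a given edge at the
    root has conductance at most del. *)
Lemma annealed_never_le (g K del : R) (pi : set (V * V)) :
  (forall n : nat, (0 < n)%N -> exists a x, [/\ 0 < a, a <= x &
    x^-1 + expR 1 * expR (- (n%:R * (a / x) * G a / 2)) <= K * n%:R `^ (- g)]) ->
  0 <= K -> 0 < del -> del <= 1 -> cutsets adj root pi ->
  (annealed P Q never <= (G del^-1)%:E +
    (del^-1 * K)%:E * \esum_(e in pi) ((edge_level adj root e)%:R `^ (- g))%:E)%E.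
Proof.
move=> rate K0 d0 d1 cpi.
have [k cross] := cutset_bounded tree lf cpi.
(* The conductance of this edge bounds the total conductance at the root from below. *)
have [v0 v0r] := root_child; have v0n := child_neq tree lf v0r.
have he := edges_parent tree v0n; set e0 := (parent v0, v0) in he.
have /choice[a /choice[x ax]] : forall n : nat, exists a, exists x, (0 < n)%N ->
    [/\ 0 < a, a <= x &
    x^-1 + expR 1 * expR (- (n%:R * (a / x) * G a / 2)) <= K * n%:R `^ (- g)].
  move=> n; case: (posnP n) => [->|/rate[a [x h]]]; first by exists 0, 0.
  by exists a, x.
pose s := root_frontier adj root pi k.
have sP u : u \in s -> u <> root by move=> /(mem_root_frontier tree lf)[].
have sL u : u \in s -> (0 < level u)%N.
  by move=> /sP ur; rewrite (level_parent tree ur).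
pose H u w := hit_bound (x (level u)) (a (level u) / x (level u) /
   (1 + a (level u) / x (level u))) (a (level u))^-1 (path_edges adj root u) (cond w).
have HR u w : u \in s ->
    Num.min 1 (path_resistance adj root (cond w) u)^-1 <= H u w.
  move=> us; have [a0 ax0 _] := ax _ (sL _ us).
  rewrite path_resistance_edges; apply: hit_bound_ge => // e.
  by move=> /(path_edges_edges tree) /C_gt0.
have R0 u w : 0 <= (path_resistance adj root (cond w) u)^-1.
  by rewrite invr_ge0; apply: (path_resistance_ge0 tree) => e /C_gt0.
have H0 u w : u \in s -> 0 <= H u w.
  by move=> /(HR u w); apply: le_trans; rewrite le_min ler01 R0.
have mH u : measurable_fun [set: Omega] (H u) by exact: measurable_hit_bound.
pose A := [set w | C e0 w <= del].
have mA : measurable A by exact: measurable_le_event.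
have PA : P A = (G del^-1)%:E.
  by rewrite -(C_tail he) ?invr_gt0 // div1r invrK.
pose F w := \1_A w + del^-1 * \sum_(u <- s) H u w.
have S0 w : 0 <= \sum_(u <- s) H u w.
  by rewrite big_seq sumr_ge0 // => u us; exact: H0.
have mS : measurable_fun [set: Omega] (fun w => \sum_(u <- s) H u w).
  by apply: measurable_sum_seq => u _.
have QF w : fine (Q w never) <= F w.
  have Q1 : fine (Q w never) <= 1.
    rewrite -lee_fin fineK ?(quenched_never_fin X_walk) //.
    exact: quenched_never_le1 X_walk w.
  have DS0 : 0 <= del^-1 * \sum_(u <- s) H u w by rewrite mulr_ge0 // invr_ge0 ltW.
  rewrite /F indicE; have [wA|wA] := boolP (w \in A).
    by rewrite (le_trans Q1) // lerDl.
  rewrite add0r.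
  have Cw : del < C e0 w.
    by rewrite ltNge; apply/negP => h; move/negP: wA; apply; rewrite inE.
  have tot : del <= total_cond adj root (cond w) root.
    rewrite /total_cond eqxx add0r /child_sum (perm_big _ (perm_to_rem v0r)) big_cons.
    rewrite (le_trans (ltW Cw)) // lerDl big_seq sumr_ge0 // => u /mem_rem ur.
    by rewrite ltW // (up_cond_child_gt0 tree lf _ ur) // => e /C_gt0.
  have dinv : 1 <= del^-1 by rewrite invr_ge1 ?unitfE ?gt_eqF.
  set Sg := \sum_(u <- s) (path_resistance adj root (cond w) u)^-1.
  have le_min1 : Num.min 1 Sg <= \sum_(u <- s) H u w.
    rewrite (le_trans (min_sum_le _)) // big_seq [leRHS]big_seq.
    by apply: ler_sum => u us; exact: HR.
  apply: (@le_trans _ _ (del^-1 * Num.min 1 Sg)); last first.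
    by rewrite ler_wpM2l // invr_ge0 ltW.
  case: (leP 1 Sg) => hS; first by rewrite mulr1 (le_trans Q1).
  have := quenched_never_le tree lf Vinf C_gt0 X_walk w k.
  rewrite -(fineK (quenched_never_fin X_walk w)) lee_fin => /le_trans; apply.
  have T0 : 0 < total_cond adj root (cond w) root by exact: lt_le_trans tot.
  rewrite mulrC; apply: ler_pM => //.
  - by rewrite invr_ge0 ltW.
  - by apply: branch_sum_ge0 => // e /C_gt0.
  - by rewrite lef_pV2.
  by apply: branch_sum_le_frontier => // e /C_gt0.
rewrite annealed_expect; apply: (@le_trans _ _ (expect P F)).
  apply: expect_le => //.
  - apply: measurableT_comp => //; apply: measurable_kernel; exact: measurable_never X_walk.
  - apply: measurable_funD; first exact: measurable_indic.
    exact: measurable_funM.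
rewrite /F expectD //; first last.
- exact: measurable_funM.
- by move=> w; rewrite mulr_ge0 // invr_ge0 ltW.
rewrite expect_indic // PA leeD2l //.
rewrite expectZ ?invr_ge0 ?(ltW d0) // EFinM -muleA lee_wpmul2l ?lee_fin ?invr_ge0 ?(ltW d0) //.
rewrite expect_sum //; last by move=> u us w; exact: H0.
apply: (@le_trans _ _ (K%:E * (\sum_(u <- s) (level u)%:R `^ (- g))%:E)%E); last first.
  rewrite lee_wpmul2l ?lee_fin //.
  apply: (@root_frontier_esum V adj root tree lf pi R k
    (fun e => (edge_level adj root e)%:R `^ (- g))) => e.
  exact: powR_ge0.
rewrite -EFinM mulr_sumr -sumEFin big_seq [leRHS]big_seq; apply: lee_sum => u us.
have [a0 ax0 le] := ax _ (sL _ us).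
apply: (le_trans (expect_hit_bound tree C_ind C_tail u a0 ax0 (tail_bounds a0))).
by rewrite lee_fin.
Qed.

(** Choose del so that G(1/del) is small, and then a cutset whose sum is small
    compared with del. *)
Lemma recurrent_of_decay (g m1 K1 : R) : 0 < m1 ->
  (forall t, 1 <= t -> G t * t `^ m1 <= K1) -> decay_rate G g ->
  (forall eps : R, 0 < eps -> exists2 pi, cutsets adj root pi &
    (\esum_(e in pi) ((edge_level adj root e)%:R `^ (- g))%:E < eps%:E)%E) ->
  recurrent P Q X root.
Proof.
move=> m0 GK [K K0 rate] cut_small; rewrite /recurrent /transient; apply/negP.
rewrite -leNgt; apply/lee_addgt0Pr => eps eps0; rewrite add0e.
have e2 : 0 < eps / 2 by rewrite divr_gt0.
(* t = 1/del; its size makes K1 t^-m1 <= eps / 2. *)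
pose t := Num.max 1 ((K1 / (eps / 2)) `^ m1^-1).
have t1 : 1 <= t by rewrite le_max lexx.
have t0 : 0 < t by exact: lt_le_trans t1.
have K10 : 0 <= K1.
  have /andP[G0 _] := tail_bounds ltr01.
  by apply: le_trans (GK 1 (lexx _)); rewrite mulr_ge0 ?powR_ge0.
have Gt : G t <= eps / 2.
  have tm : K1 / (eps / 2) <= t `^ m1.
    apply: (@le_trans _ _ (((K1 / (eps / 2)) `^ m1^-1) `^ m1)).
      by rewrite -powRrM mulVf ?gt_eqF // powRr1 // divr_ge0 // ltW.
    by rewrite ge0_ler_powR ?nnegrE ?powR_ge0 ?(ltW m0) ?(ltW t0) // le_max lexx orbT.
  have := GK t t1; rewrite -ler_pdivlMr ?powR_gt0 // => /le_trans; apply.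
  by rewrite ler_pdivrMr ?powR_gt0 // mulrC -ler_pdivrMr.
pose eta := eps / 2 / (t * (K + 1)).
have eta0 : 0 < eta by rewrite divr_gt0 // mulr_gt0 // ltr_wpDl.
have [pi cpi pis] := cut_small eta eta0.
have d1 : t^-1 <= 1 by rewrite invf_le1.
have d0 : 0 < t^-1 by rewrite invr_gt0.
apply: (le_trans (annealed_never_le rate K0 d0 d1 cpi)).
rewrite invrK [eps]splitr EFinD leeD ?lee_fin //.
apply: (@le_trans _ _ ((t * K)%:E * eta%:E)%E).
  by rewrite lee_wpmul2l ?lee_fin ?mulr_ge0 ?(ltW t0) ?(ltW pis).
rewrite -EFinM lee_fin /eta mulrA ler_pdivrMr ?mulr_gt0 ?ltr_wpDl //.
by rewrite mulrC ler_wpM2l ?(ltW e2) // ler_wpM2l ?(ltW t0) // lerDl.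
Qed.

End Recurrence.

(** * Transience *)

Section Transience.
Context (R : realType) (V : choiceType) (adj : rel V) (root : V).
Context (tree : is_tree adj) (lf : locally_finite adj) (Vinf : infinite_set [set: V]).
Context (dO dW : measure_display) (Omega : measurableType dO) (P : probability Omega R).
Context (C : V * V -> {RV P >-> R}).
Context (C_gt0 : forall e, edges adj root e -> forall w, 0 < C e w).
Context (W : measurableType dW) (Q : R.-pker Omega ~> W) (X : nat -> W -> V).
Context (X_walk : is_rwrc adj root C Q X).
Local Notation level := (level adj root).
Local Notation parent := (parent adj root).
Local Notation children := (children adj root).
Local Notation cond w := (fun e => C e w).
Local Notation never := [set w | return_time R X root w = +oo%E].

Lemma measurable_total_cond :
  measurable_fun [set: Omega] (fun w => total_cond adj root (cond w) root).
Proof.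
rewrite /total_cond eqxx; apply: measurable_funD => //.
by apply: measurable_sum_seq => u _; exact: measurable_funP.
Qed.

Lemma total_cond_bounded_half : exists2 B : R, 0 < B &
  ((2^-1)%:E <= P [set w | (total_cond adj root (cond w) root <= B)%R])%E.
Proof.
pose F (n : nat) := [set w | total_cond adj root (cond w) root <= n%:R].
have mF n : measurable (F n).
  rewrite (_ : F n = (fun w => total_cond adj root (cond w) root) @^-1` `]-oo, n%:R]).
    by rewrite -[X in measurable X]setTI; exact: measurable_total_cond.
  by apply/seteqP; split => w /=; rewrite in_itv.
have FT : \bigcup_n F n = setT.
  apply/seteqP; split => // w _.
  have t0 : 0 <= total_cond adj root (cond w) root.
    by rewrite ltW // total_cond_gt0 // => e /C_gt0.
  exists (Num.bound (total_cond adj root (cond w) root)) => //=.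
  by rewrite /F /= ltW // archi_boundP.
have cvgF : (P \o F) n @[n --> \oo] --> 1%E.
  rewrite -(probability_setT P) -FT; apply: nondecreasing_cvg_mu => //.
    by rewrite FT.
  by move=> n m nm; apply/subsetPset => w /= /le_trans; apply; rewrite ler_nat.
apply: contrapT => H.
have : ((1 : \bar R) <= (2^-1)%:E)%E.
  apply: (cvge_to_le cvgF); apply: nearW => n /=.
  apply/ltW; rewrite ltNge; apply/negP => h; apply: H.
  exists n.+1%:R => //; apply: (le_trans h); apply: le_measure; rewrite ?inE //.
    exact: mF n.+1.
  by move=> w /= /le_trans; apply; rewrite ler_nat.
by rewrite lee_fin leNgt invf_lt1 // ltr1n.
Qed.

Context (g k M c0 : R) (k0 : 0 < k) (M0 : 0 <= M) (gk : 1 < g * k) (c0_gt0 : 0 < c0).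
Context (C_mean : forall e, edges adj root e -> forall x : R, 0 <= x -> x <= 1 ->
  (expect P (fun w => Num.min 1%R (x / C e w)%R) <= (M * x `^ k)%:E)%E).
Context (cut_big : forall pi, cutsets adj root pi ->
  (c0%:E <= \esum_(e in pi) ((edge_level adj root e)%:R `^ (- g))%:E)%E).

Local Notation q := (level_weight adj root g).

(** On the event A that the total conductance at the root is at most B, of
    probability at least 1/2, the strength x is at most B times the probability
    of no return plus the loss of the flow.  Taking means, with a mean loss of
    at most x / 4, leaves x / (4 B) for the former, uniformly in the depth. *)
Lemma transient_of_moment : transient P Q X root.
Proof.
pose del := g * k - 1; have d0 : 0 < del by rewrite subr_gt0.
have gkd : g * k = 1 + del by rewrite /del; ring.
have g0 : 0 < g by rewrite -(pmulr_lgt0 _ k0) (lt_trans ltr01).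
pose Z := zeta_tail del 1; have Z0 : 0 <= Z by exact: zeta_tail_ge0.
(* eta is chosen so that M eta^k Z <= 1/4. *)
pose D := 4 * (M * Z + 1).
have D0 : 0 < D by rewrite mulr_gt0 // ltr_wpDl // mulr_ge0.
have D1 : 1 <= D by rewrite /D; have := mulr_ge0 M0 Z0; lra.
pose eta := D `^ (- k^-1); have eta0 : 0 < eta by rewrite powR_gt0.
have eta1 : eta <= 1.
  by rewrite /eta powRN invf_le1 ?powR_gt0 // powR_ge1 // invr_ge0 ltW.
have etak : eta `^ k = D^-1.
  by rewrite -powRrM mulNr mulVf ?gt_eqF // powR_inv1 // ltW.
pose x := eta * c0; have x0 : 0 < x by rewrite mulr_gt0.
have [B B0 PB] := total_cond_bounded_half.
pose A := [set w | total_cond adj root (cond w) root <= B].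
have mA : measurable A.
  rewrite (_ : A = (fun w => total_cond adj root (cond w) root) @^-1` `]-oo, B]).
    by rewrite -[X in measurable X]setTI; exact: measurable_total_cond.
  by apply/seteqP; split => w /=; rewrite in_itv.
apply: (@lt_le_trans _ _ (x / (4 * B))%:E); first by rewrite lte_fin divr_gt0 // mulr_gt0.
apply: (annealed_never_ge tree lf Vinf C_gt0 X_walk) => N.
have q0 := level_weight_ge0 adj root g.
have xs : x <= eta * mincut_sum adj root q N root.
  by rewrite ler_wpM2l ?(ltW eta0) // mincut_lower_bound.
pose sub := subflow adj root q N root x.
have sub0 u : 0 <= sub u by apply: subflow_ge0 => //; exact: ltW.
pose loss u w := flow_loss adj root q (cond w) N (sub u) u.
have loss0 u w : u \in children root -> 0 <= loss u w.
  by move=> /(child_neq tree lf) ur; apply: flow_loss_ge0 => // e /C_gt0.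
have mloss u : u \in children root -> measurable_fun [set: Omega] (loss u).
  by move=> /(child_neq tree lf) ur; exact: measurable_flow_loss.
pose pen w := \sum_(u <- children root) loss u w.
have pen0 w : 0 <= pen w by rewrite /pen big_seq sumr_ge0 // => u /loss0.
have mpen : measurable_fun [set: Omega] pen by exact: measurable_sum_seq.
have Epen : (expect P pen <= (x / 4)%:E)%E.
  rewrite expect_sum //; last by move=> u uc w; exact: loss0.
  apply: (@le_trans _ _ (\sum_(u <- children root) (sub u * (M * eta `^ k * Z))%:E)%E).
    rewrite big_seq [leRHS]big_seq; apply: lee_sum => u uc.
    have ur := child_neq tree lf uc.
    have -> : Z = zeta_tail del (level u).
      by rewrite (level_parent tree ur) (parent_child tree lf uc) level_root.
    apply: (expect_flow_loss tree lf C_gt0 g0 k0 M0 eta0 eta1 d0 gkd C_mean) => //.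
    by apply: subflow_le xs => //; exact: ltW.
  rewrite sumEFin lee_fin -mulr_suml (sum_subflow (ltW x0) xs) ler_wpM2l ?(ltW x0) //.
  rewrite etak mulrAC ler_pdivrMr // /D mulrA mulVf ?mul1r ?lerDl //.
pose f w := no_return adj root (cond w) N.
have f0 w : 0 <= f w := no_return_ge0 tree lf Vinf C_gt0 X_walk w N.
have mf : measurable_fun [set: Omega] f := measurable_no_return tree lf Vinf C_gt0 X_walk N.
have key w : x * \1_A w <= B * f w + pen w.
  rewrite indicE; have [wA|wA] := boolP (w \in A); last first.
    by rewrite mulr0 addr_ge0 // mulr_ge0 // ltW.
  rewrite inE in wA; rewrite mulr1 -lerBlDr.
  have cw0 : forall e, edges adj root e -> 0 < C e w by move=> e /C_gt0.
  have T0 := total_cond_gt0 tree lf cw0 Vinf root.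
  apply: (le_trans (branch_sum_flow tree lf q0 cw0 (ltW eta0) (ltW x0) xs)).
  have := quenched_no_return_ge tree lf Vinf C_gt0 w N.
  rewrite ler_pdivrMr // => /le_trans; apply.
  by rewrite mulrC ler_wpM2r // f0.
have mind : measurable_fun [set: Omega] (\1_A : Omega -> R) by exact: measurable_indic.
have Ekey : (x%:E * P A <= B%:E * expect P f + expect P pen)%E.
  rewrite -expect_indic // -(expectZ P (ltW x0) _ mind) //.
  rewrite -(expectZ P (ltW B0) f0 mf) -expectD //; first last.
  - exact: measurable_funM.
  - by move=> w; rewrite mulr_ge0 // ltW.
  apply: expect_le => //.
  - by move=> w; rewrite mulr_ge0 // ltW.
  - exact: measurable_funM.
  by apply: measurable_funD => //; exact: measurable_funM.
have : ((x / 2)%:E <= B%:E * expect P f + (x / 4)%:E)%E.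
  apply: (@le_trans _ _ (x%:E * P A)%E).
    by rewrite EFinM lee_wpmul2l // lee_fin ltW.
  by apply: (le_trans Ekey); rewrite leeD2l.
change (((x / 2)%:E <= B%:E * expect P f + (x / 4)%:E)%E ->
  ((x / (4 * B))%:E <= expect P f)%E).
have := expect_ge0 P f0; case: (expect P f) => [r _|_ _|]; last 2 first.
- by rewrite leey.
- by rewrite leeNy_eq.
rewrite -EFinM -EFinD !lee_fin => h; rewrite ler_pdivrMr ?mulr_gt0 //.
by move: h; lra.
Qed.

End Transience.

(** * The critical value *)

Section BranchingRuin.
Context (R : realType) (V : choiceType) (adj : rel V) (root : V).
Local Notation b := (branching_ruin adj root R).
Local Notation weight g := (fun e : V * V => ((edge_level adj root e)%:R `^ (- g))%:E : \bar R).

Lemma small_cutset (g : R) : 0 < g -> (b < g%:E)%E -> forall eps : R, 0 < eps ->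
  exists2 pi, cutsets adj root pi & (\esum_(e in pi) weight g e < eps%:E)%E.
Proof.
move=> g0 bg eps eps0.
set I := [set \esum_(e in pi) weight g e | pi in cutsets adj root].
have : (ereal_inf I <= 0)%E.
  rewrite leNgt; apply/negP => h; move: bg; rewrite ltNge => /negP; apply.
  by rewrite /branching_ruin le_max; apply/orP; right; apply: ereal_sup_ubound; exists g.
move=> /le_lt_trans /(_ (eps0 : (0 < eps%:E)%E)) /ereal_inf_lt[_ [pi cpi <-] h].
by exists pi.
Qed.

Lemma big_cutsets (l : R) : 0 <= l -> (l%:E < b)%E -> exists g c0 : R,
  [/\ l < g, 0 < c0 & forall pi, cutsets adj root pi ->
    (c0%:E <= \esum_(e in pi) weight g e)%E].
Proof.
move=> l0; rewrite /branching_ruin lt_max lte_fin [l < 0]ltNge l0 /=.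
move=> /ereal_sup_gt[_ [g [g0 hinf] <-] lg].
set I := ereal_inf _ in hinf.
have [c0 c00 c0I] : exists2 c0 : R, 0 < c0 & (c0%:E <= I)%E.
  move: hinf; case: I => [r| |] //; first by rewrite lte_fin => r0; exists r.
  by exists 1; rewrite ?leey.
exists g, c0; split => // pi cpi; apply: (le_trans c0I).
by apply: ereal_inf_lbound; exists pi.
Qed.

End BranchingRuin.

Theorem theorem1 (R : realType)
  (V : choiceType) (adj : rel V) (root : V)
  (tree : is_tree adj)
  (lf : locally_finite adj)
  (inf : infinite_set [set: V])
  (dO dW : measure_display)
  (Omega : measurableType dO) (P : probability Omega R)
  (C : V * V -> {RV P >-> R})
  (C_iid : iid (edges adj root) C)
  (C_gt0 : forall e, edges adj root e -> forall omega, 0 < C e omega)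
  (m : R) (m_gt0 : 0 < m)
  (L : R -> R) (L_sv : slowly_varying L)
  (C_tail : forall e, edges adj root e -> forall t : R, 0 < t ->
     P [set omega | C e omega <= 1 / t] = (L t / t `^ m)%:E)
  (C_norm : forall e, edges adj root e ->
     (0 < P [set omega | (1 <= C e omega)%R])%E)
  (W : measurableType dW) (Q : R.-pker Omega ~> W) (X : nat -> W -> V)
  (X_walk : is_rwrc adj root C Q X) :
  let b := branching_ruin adj root R in
  ((b < 1)%E -> recurrent P Q X root) /\
  ((1 < b)%E ->
     ((1 < m%:E * b)%E -> transient P Q X root) /\
     ((m%:E * b < 1)%E -> recurrent P Q X root)).
Proof.
move=> b; pose G t := L t / t `^ m.
have C_ind : mutually_independent (edges adj root) C by case: C_iid.
have G01 t : 0 < t -> 0 <= G t <= 1 by exact: (tail_bounds tree lf inf C_tail).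
have G_mono s t : 0 < s -> s <= t -> G t <= G s.
  exact: (tail_nonincreasing tree lf inf C_tail).
have upper m1 : 0 <= m1 -> m1 < m ->
    exists2 K, 0 < K & forall t, 1 <= t -> G t * t `^ m1 <= K.
  move=> m10 m1m; have [|t0 t01 H] := tail_double_eventually L_sv m1m (m2 := m + 1).
    by rewrite ltrDl.
  by apply: (doubling_upper m10 t01) => t; [case/G01/andP | case/H].
have m2_gt0 : 0 < m / 2 by rewrite divr_gt0.
have m2_lt : m / 2 < m by rewrite ltr_pdivrMr // ltr_pMr // ltr1n.
have [K1 _ HK1] := upper _ (ltW m2_gt0) m2_lt.
have rec g := @recurrent_of_decay R V adj root tree lf inf _ _ _ P C C_ind C_gt0 G
  C_tail W Q X X_walk g _ _ m2_gt0 HK1.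
have b_ge0 : (0 <= b)%E by rewrite /b /branching_ruin le_max lexx.
split.
  move=> b1; have [r r0 br] : exists2 r : R, 0 <= r & b = r%:E.
    by case: b b_ge0 b1 => [r r0 _| |] //; exists r.
  rewrite br lte_fin in b1; pose g := (r + 1) / 2.
  have g0 : 0 < g by rewrite /g; lra.
  have g1 : g < 1 by rewrite /g; lra.
  apply: (rec g); last first.
    by apply: small_cutset => //; rewrite -/b br lte_fin /g; lra.
  have [|t0 t01 H] := tail_double_eventually L_sv m2_lt (m2 := m + 1); first by rewrite ltrDl.
  have [Gt0 _ _] := H t0 (lexx _).
  exact: decay_rate_sum g0 g1 (lt_le_trans ltr01 t01) Gt0.
move=> b1; split => mb.
  pose l := Num.max 1 m^-1.
  have lb : (l%:E < b)%E.
    rewrite /l; case: (leP 1 m^-1) => // _.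
    case: b {b_ge0} b1 mb => [r| |] // _; last by rewrite ltry.
    by rewrite -EFinM !lte_fin mulrC -ltr_pdivrMr // div1r.
  have l0 : 0 <= l by rewrite le_max ler01.
  have [g [c0 [lg c00 big]]] := big_cutsets l0 lb.
  have [g1 gm] : 1 < g /\ m^-1 < g by move: lg; rewrite /l gt_max => /andP.
  have g0 : 0 < g by exact: lt_trans g1.
  pose mm := Num.min m 1; have gmm : g^-1 < mm.
    by rewrite lt_min invf_lt1 // g1 andbT -[m]invrK ltf_pV2 ?posrE ?invr_gt0.
  (* Any exponents 1/g < k < m1 < min(m, 1) will do. *)
  pose k := (g^-1 * 2 + mm) / 3; pose m1 := (g^-1 + mm * 2) / 3.
  have ginv : 0 < g^-1 by rewrite invr_gt0.
  have k0 : 0 < k by rewrite /k; lra.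
  have km : k < m1 by rewrite /k /m1; lra.
  have mm1 : m1 < mm by rewrite /m1; lra.
  have [m1m m11] : m1 < m /\ m1 < 1 by move: mm1; rewrite /mm lt_min => /andP.
  have gk : 1 < g * k by rewrite mulrC -ltr_pdivrMr // div1r /k; lra.
  have m10 : 0 <= m1 by rewrite ltW // (lt_trans k0).
  have [K K0 HK] := upper m1 m10 m1m.
  have [M M0 HM] := truncated_mean P k0 km m11 (ltW K0).
  apply: (transient_of_moment tree lf inf C_gt0 X_walk k0 M0 gk c00) => //.
  move=> e he x x0 x1; apply: HM => //; first exact: C_gt0.
  move=> t t1; have t0 : 0 < t by exact: lt_le_trans t1.
  by rewrite (C_tail e he t t0) lee_fin ler_pdivlMr ?powR_gt0 // HK.
have [r r1 br] : exists2 r : R, 1 < r & b = r%:E.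
  case: b {b_ge0} b1 mb => [r| |] //; first by rewrite lte_fin => r1 _; exists r.
  by rewrite mulry gtr0_sg // mul1e.
rewrite br -EFinM lte_fin in mb.
have rm : r < m^-1 by rewrite -div1r ltr_pdivlMr // mulrC.
pose g := (r + m^-1) / 2.
have g0 : 0 < g by rewrite /g; lra.
have gm : g < m^-1 by rewrite /g; lra.
have mg : m < g^-1 by rewrite -[m]invrK ltf_pV2 ?posrE ?invr_gt0.
pose m2 := (m + g^-1) / 2.
have mm2 : m < m2 by rewrite /m2; lra.
have m2g : m2 * g < 1 by rewrite -ltr_pdivlMr // div1r /m2; lra.
have m20 : 0 <= m2 by rewrite ltW // (lt_trans m_gt0).
apply: (rec g); last first.
  by apply: small_cutset => //; rewrite -/b br lte_fin /g; lra.
have [t0 t01 H] := tail_double_eventually L_sv m2_lt mm2.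
have t00 : 0 < t0 by exact: lt_le_trans t01.
have G2 : 0 < G (2 * t0).
  by have [] := H (2 * t0); rewrite ?ler_peMl ?ler1n // ltW.
have low := doubling_lower m20 t00 G_mono G2 (fun t ht => let: And3 _ _ h := H t ht in h).
apply: (decay_rate_max g0 m20 m2g t00 _ low).
by rewrite mulr_gt0 // powR_gt0.
Qed.
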